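(* Let $(a_n)_{n\geq1}$ be a sequence of integers such that for some $t \in \mathbb{N}$ we have $|a_n| \leq n^t$ for all sufficiently large $n$. Assume there exist $\tau \in (0,1)$, reals $1 < B' < B$, and a strictly increasing sequence $(B_L)_{L\geq1}$ of positive integers with $(B')^L \leq B_L \leq B^L$ for all $L$, such that for every $\varepsilon > 0$ there is $L(\varepsilon)$ with $$\int_0^1 \left| \sum_{n=1}^{B_L} e^{2\pi i a_n \alpha} \right| d\alpha > B_L^{\tau - \varepsilon} \qquad \text{for all } L > L(\varepsilon).$$ Then for almost all $\alpha \in [0,1)$ the discrepancy $D_N$ of $(\{a_n\alpha\})_{n\geq1}$ satisfies: for every $\varepsilon>0$ there are infinitely many $N$ with $N D_N > N^{\tau - \varepsilon}$.
   Context: For real $x$, $\{x\}$ denotes the fractional part of $x$. For a sequence $(x_n)_{n\ge1}$ in $[0,1)$, its discrepancy is $$D_N = \sup_{0 \leq a < b \leq 1} \left| \frac{A_N([a,b))}{N} - (b-a) \right|, \qquad A_N([a,b)) = \#\{1 \leq n \leq N : x_n \in [a,b)\}.$$ *)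

(* Defs.v *)
From Stdlib Require Import Reals Lra Lia.
Open Scope R_scope.

Fixpoint ssum (f : nat -> R) (M : nat) : R :=
  match M with
  | O => 0
  | S m => ssum f m + f (S m)
  end.

Fixpoint count_in (x : nat -> R) (a b : R) (N : nat) : nat :=
  match N with
  | O => O
  | S m => (count_in x a b m +
            (if Rle_dec a (x (S m)) then
               (if Rlt_dec (x (S m)) b then 1 else 0) else 0))%nat
  end.

Lemma count_in_le x a b N : (count_in x a b N <= N)%nat.
Proof.
  induction N as [|m IH]; simpl; [lia|].
  destruct (Rle_dec a (x (S m))); [destruct (Rlt_dec (x (S m)) b)|]; lia.
Qed.

Definition disc_set (x : nat -> R) (N : nat) (y : R) : Prop :=
  exists a b, 0 <= a /\ a < b /\ b <= 1 /\
    y = Rabs (INR (count_in x a b N) / INR N - (b - a)).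

Lemma disc_set_bound x N : bound (disc_set x N).
Proof.
  exists 2. intros y [a [b [Ha [Hab [Hb ->]]]]].
  assert (Hc : 0 <= INR (count_in x a b N) / INR N <= 1).
  { destruct N as [|N].
    - assert (count_in x a b 0 = 0%nat) as -> by reflexivity.
      simpl. unfold Rdiv. rewrite Rmult_0_l. lra.
    - pose proof (count_in_le x a b (S N)) as Hle.
      apply le_INR in Hle. pose proof (pos_INR (count_in x a b (S N))).
      assert (0 < INR (S N)) by (apply lt_0_INR; lia).
      split.
      + apply Rmult_le_pos; [lra|]. left. apply Rinv_0_lt_compat. lra.
      + apply Rmult_le_reg_r with (INR (S N)); [lra|].
        unfold Rdiv. rewrite Rmult_assoc, Rinv_l by lra. lra. }
  unfold Rabs. destruct (Rcase_abs _); lra.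
Qed.

Lemma disc_set_ne x N : exists y, disc_set x N y.
Proof.
  exists (Rabs (INR (count_in x 0 1 N) / INR N - (1 - 0))).
  exists 0, 1. repeat split; try lra; reflexivity.
Qed.

Definition discrepancy (x : nat -> R) (N : nat) : R :=
  proj1_sig (completeness (disc_set x N) (disc_set_bound x N) (disc_set_ne x N)).

Definition null_set (S : R -> Prop) : Prop :=
  forall eps, 0 < eps ->
    exists c d : nat -> R,
      (forall k, c k <= d k) /\
      (forall n, sum_f_R0 (fun k => d k - c k) n <= eps) /\
      (forall y, S y -> exists k, c k < y < d k).

(* | sum_{n=1}^{M} e^{2 pi i a_n alpha} | *)
Definition exp_sum_abs (a : nat -> Z) (M : nat) (alpha : R) : R :=
  sqrt ((ssum (fun n => cos (2 * PI * IZR (a n) * alpha)) M) ^ 2 +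
        (ssum (fun n => sin (2 * PI * IZR (a n) * alpha)) M) ^ 2).

(* Main.v *)
Require Import Defs.
From Stdlib Require Import ZArith Reals Lra Lia List IndefiniteDescription Classical.
From mathcomp Require all_boot all_order all_algebra zify complex Rstruct.
From Coquelicot Require Coquelicot.
From Coquelicot Require Import Rcomplements.
Open Scope R_scope.
Delimit Scope R_scope with coqR.

(** Write N = B_L, f(x) = |sum_(n <= N) e(a_n x)| and U for the mean of f. By Koksma's
    inequality f(h alpha) <= 2 pi h N D_N(alpha) for every h >= 1, so it suffices to
    find, for most alpha, an h with f(h alpha) > h V, where V is N^(tau - 4e).
    The layers G_h = min(1, max(0, f / V - h)) are supported on {f > h V}, and their
    means add up to about U / V >= N^(3e). The variance of sum_h G_h(h alpha) is at
    most this total mean times the largest number of divisors of an integer below a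
    power of N, hence times N^e, because the Fourier coefficients of G_h beyond a power
    of N are negligible. By Chebyshev, outside a set of measure O(N^(-2e)) some
    G_h(h alpha) is positive.

    Everything is done on the grid (1/Q)Z with Q a power of N: the functions involved
    are Lipschitz with a constant polynomial in N, so integrals become averages over
    Z/Q, Fourier series become discrete Fourier transforms, and the exceptional set is
    covered by finitely many grid cells. *)

(** * The divisor bound *)

Module DivisorBound.
Import all_boot.
Set Implicit Arguments.
Unset Strict Implicit.
Local Open Scope nat_scope.

Lemma size_divisorsM a b : 0 < a -> 0 < b ->
  size (divisors (a * b)) <= size (divisors a) * size (divisors b).
Proof.
move=> a0 b0; have ab0 : 0 < a * b by rewrite muln_gt0 a0.
rewrite -(size_allpairs muln).
apply: uniq_leq_size (divisors_uniq _) _ => d.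
rewrite -dvdn_divisors // => dab.
have d0 : 0 < d by apply: dvdn_gt0 dab.
have g0 : 0 < gcdn d a by rewrite gcdn_gt0 d0.
apply/allpairsP; exists (gcdn d a, d %/ gcdn d a); split => /=.
- by rewrite -dvdn_divisors // dvdn_gcdr.
- rewrite -dvdn_divisors // -(@Gauss_dvdr _ (a %/ gcdn d a)).
    rewrite -(dvdn_pmul2l g0) [in X in X %| _]mulnC divnK ?dvdn_gcdl //.
    by rewrite mulnA [gcdn d a * _]mulnC divnK // dvdn_gcdr.
  by rewrite /coprime -(eqn_pmul2l g0) muln_gcdr muln1 ![gcdn d a * (_ %/ _)]mulnC
    !divnK ?dvdn_gcdl ?dvdn_gcdr.
- by rewrite mulnC divnK // dvdn_gcdl.
Qed.

Lemma size_divisors_pfactor_le p e : prime p -> size (divisors (p ^ e)) <= e.+1.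
Proof.
move=> p_pr; rewrite -[leqRHS](size_iota 0) -(size_map (expn p) (iota 0 e.+1)).
apply: uniq_leq_size (divisors_uniq _) _ => d.
rewrite -dvdn_divisors ?expn_gt0 ?prime_gt0 // => /dvdn_pfactor [] // i ie ->.
by apply: map_f; rewrite mem_iota add0n ltnS.
Qed.

Lemma expn_succ_le s e : 0 < s -> e.+1 ^ s <= s ^ s * 2 ^ e.
Proof.
move=> s0; apply: (@leq_trans ((s * 2 ^ (e %/ s)) ^ s)).
  rewrite leq_exp2r //; apply: (@leq_trans (s * (e %/ s).+1)).
    by rewrite mulnC ltn_ceil.
  by rewrite leq_mul2l ltn_expl ?orbT.
by rewrite expnMn -expnM leq_mul2l leq_exp2l // leq_divM orbT.
Qed.

Lemma size_divisors_pfactorX_le s p e : 0 < s -> prime p ->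
  size (divisors (p ^ e)) ^ s <= (if p < 2 ^ s then s ^ s else 1) * p ^ e.
Proof.
move=> s0 p_pr; apply: (@leq_trans (e.+1 ^ s)).
  by rewrite leq_exp2r // size_divisors_pfactor_le.
have leq_expe k : k <= p -> k ^ e <= p ^ e by case: e => // e; rewrite leq_exp2r.
case: ltnP => [_|p_large].
  by apply: leq_trans (expn_succ_le e s0) _; rewrite leq_mul2l leq_expe ?prime_gt1 ?orbT.
rewrite mul1n; apply: leq_trans (leq_expe _ p_large).
by rewrite -expnM mulnC expnM leq_exp2r // ltn_expl.
Qed.

Lemma prod_if_ltn_le (r : seq nat) b c : uniq r -> 0 < c ->
  \prod_(p <- r) (if p < b then c else 1) <= c ^ b.
Proof.
move=> r_uniq c0.
have -> : \prod_(p <- r) (if p < b then c else 1) = c ^ count (fun p => p < b) r.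
  elim: r {r_uniq} => [|p r IH]; first by rewrite big_nil.
  by rewrite big_cons IH /=; case: ifP => _; rewrite ?mul1n // -expnS.
rewrite leq_pexp2l // -size_filter -[leqRHS](size_iota 0).
apply: uniq_leq_size (filter_uniq _ r_uniq) _ => p.
by rewrite mem_filter mem_iota add0n => /andP[].
Qed.

Theorem divisor_bound s n : 0 < s -> 0 < n ->
  size (divisors n) ^ s <= (s ^ s) ^ (2 ^ s) * n.
Proof.
move=> s0 n0.
have decomp := prod_prime_decomp n0; rewrite prime_decompE big_map /= in decomp.
have submult : 0 < n /\ size (divisors n) ^ s <=
    \prod_(p <- primes n) size (divisors (p ^ logn p n)) ^ s.
  rewrite {1 2}decomp big_seq [X in _ ^ _ <= X]big_seq.
  elim/big_rec2: _ => [|p x y]; first by rewrite exp1n.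
  rewrite mem_primes => /andP[p_pr _] [y0 yx].
  have pe0 : 0 < p ^ logn p n by rewrite expn_gt0 prime_gt0.
  split; first by rewrite muln_gt0 pe0.
  apply: (@leq_trans ((size (divisors (p ^ logn p n)) * size (divisors y)) ^ s)).
    by rewrite leq_exp2r // size_divisorsM.
  by rewrite expnMn leq_mul2l yx orbT.
apply: leq_trans submult.2 _.
apply: (@leq_trans (\prod_(p <- primes n)
    ((if p < 2 ^ s then s ^ s else 1) * p ^ logn p n))).
  rewrite big_seq [leqRHS]big_seq; apply: leq_prod => p.
  by rewrite mem_primes => /andP[p_pr _]; apply: size_divisors_pfactorX_le.
rewrite big_split -decomp leq_mul2r prod_if_ltn_le ?orbT ?primes_uniq //.
by rewrite expn_gt0 s0.
Qed.

Lemma INR_expn m n : INR (m ^ n) = (INR m ^ n)%coqR.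
Proof. by elim: n => [|n IH] //=; rewrite expnS -multE mult_INR IH. Qed.

Theorem divisor_bound_Rpower e : (0 < e)%coqR ->
  exists C, forall n, (0 < n)%coq_nat -> (INR (size (divisors n)) <= C * Rpower (INR n) e)%coqR.
Proof.
move=> e0; have [s [inv_s /ssrnat.ltP s0]] := archimed_cor1 e e0.
exists (Rpower (INR ((s ^ s) ^ (2 ^ s))) (/ INR s)) => n /ssrnat.ltP n0.
have INR_gt0 k : 0 < k -> (0 < INR k)%coqR by move=> /ssrnat.ltP/lt_0_INR.
have C0 : 0 < (s ^ s) ^ (2 ^ s) by rewrite !expn_gt0 s0.
have d0 : 0 < size (divisors n) by case: (divisors n) (divisor1 n).
have sR := INR_gt0 _ s0; have inv_sR := Rinv_0_lt_compat _ sR.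
apply: (Rle_trans _ (Rpower (INR ((s ^ s) ^ (2 ^ s)) * INR n) (/ INR s))).
  rewrite -{1}(Rpower_1 _ (INR_gt0 _ d0)) -(Rinv_r (INR s)); last by lra.
  rewrite -Rpower_mult Rpower_pow; last exact: INR_gt0.
  apply: Rle_Rpower_l; first by lra.
  split; first by apply: pow_lt; apply: INR_gt0.
  by rewrite -INR_expn -mult_INR; apply: le_INR; apply/ssrnat.leP/divisor_bound.
rewrite -Rpower_mult_distr; [|exact: INR_gt0|exact: INR_gt0].
apply: Rmult_le_compat_l; first by left; apply: exp_pos.
by apply: Rle_Rpower; [apply: (le_INR 1); apply/ssrnat.leP | lra].
Qed.
End DivisorBound.

(** * Dilates of functions on Z/Q *)

Module FiniteFourier.
Import all_boot all_order all_algebra zify.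
Set Implicit Arguments.
Unset Strict Implicit.
Import Order.TTheory GRing.Theory Num.Theory.
Local Open Scope ring_scope.

Lemma sum_periodic_succ (V : zmodType) Q (G : nat -> V) : G Q = G 0%N ->
  \sum_(x < Q) G x.+1 = \sum_(x < Q) G x.
Proof.
case: Q => [|Q] GQ; first by rewrite !big_ord0.
by rewrite big_ord_recr [RHS]big_ord_recl /= GQ addrC.
Qed.

Lemma sum_frequencies_split (V : zmodType) Q K (F : nat -> V) : (2 * K < Q)%N ->
  \sum_(k < Q) F k = F 0%N + \sum_(k < K) F k.+1 + \sum_(k < K) F (Q - k.+1)%N +
    \sum_(k < Q | (K < k < Q - K)%N) F k.
Proof.
move=> KQ; rewrite -(big_mkord xpredT) (@big_cat_nat _ _ _ K.+1) //=; last by lia.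
rewrite (@big_cat_nat _ _ _ (Q - K) K.+1) /=; [|lia|lia].
rewrite big_mkord big_ord_recl /= -!addrA; congr (_ + (_ + _)).
rewrite addrC big_rev_mkord subKn; last by lia.
congr (_ + _); rewrite (big_nat_widenl _ 0) // (big_nat_widen _ _ Q) ?leq_subr //.
by rewrite big_mkord; apply: eq_bigl => k.
Qed.

Lemma card_factorizations_le H K n : (0 < n)%N ->
  (#|[pred p : 'I_H * 'I_K | p.1.+1 * p.2.+1 == n]| <= size (divisors n))%N.
Proof.
move=> n0; set A := [pred p | _].
have inj : {in A &, injective (fun p : 'I_H * 'I_K => p.1.+1)}.
  move=> [h k] [h' k']; rewrite !inE /= => /eqP <- /eqP e' [hh'].
  have <- : h = h' by apply: val_inj.
  congr pair; apply: val_inj; move: e'; rewrite /= -hh' => /eqP.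
  by rewrite eqn_pmul2l // eqSS => /eqP.
rewrite -(size_image (fun p : 'I_H * 'I_K => p.1.+1) A).
apply: uniq_leq_size.
  by rewrite map_inj_in_uniq ?enum_uniq // => p q; rewrite !mem_enum; apply: inj.
move=> d /imageP[p]; rewrite inE => /eqP pn ->.
by rewrite -dvdn_divisors // -pn dvdn_mulr.
Qed.

Definition average (F : fieldType) Q (G : nat -> F) : F := Q%:R^-1 * \sum_(x < Q) G x.

Section Fourier.
Context (C : numClosedFieldType).
Implicit Types (z r : C) (Q K H : nat).

Lemma sum_rel_mul_le (P : finType) (E : rel P) (w : P -> C) r :
  symmetric E -> (forall p, 0 <= w p) -> (forall p, #|E p|%:R <= r) ->
  \sum_p \sum_(q | E p q) w p * w q <= r * \sum_p w p ^+ 2.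
Proof.
move=> Esym w0 card_le.
have mean_square p q : w p * w q <= w p ^+ 2 / 2%:R + w q ^+ 2 / 2%:R.
  by rewrite -mulrDl; apply: real_leif_mean_square; apply: ger0_real.
have symmetrize : \sum_p \sum_(q | E p q) (w p ^+ 2 / 2%:R + w q ^+ 2 / 2%:R) =
    \sum_p \sum_(q | E p q) w p ^+ 2.
  under eq_bigr do rewrite big_split /=.
  rewrite big_split /= [X in _ + X](exchange_big_dep xpredT) //= -big_split /=.
  apply: eq_bigr => p _; under [X in _ + X]eq_bigl do rewrite Esym.
  by rewrite -big_split /=; apply: eq_bigr => q _; rewrite -splitr.
apply: (@le_trans _ _ (\sum_p \sum_(q | E p q) (w p ^+ 2 / 2%:R + w q ^+ 2 / 2%:R))).
  by do 2![apply: ler_sum => ? _].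
rewrite symmetrize mulr_sumr; apply: ler_sum => p _.
by rewrite sumr_const -[leLHS]mulr_natl ler_wpM2r ?exprn_ge0.
Qed.

Lemma sqr_norm_sum_le (P : finType) (w : P -> C) :
  `|\sum_p w p| ^+ 2 <= #|P|%:R * \sum_p `|w p| ^+ 2.
Proof.
apply: (@le_trans _ _ ((\sum_p `|w p|) ^+ 2)).
  by rewrite lerXn2r ?nnegrE ?sumr_ge0 ?ler_norm_sum.
rewrite expr2 mulr_suml; under eq_bigr do rewrite mulr_sumr.
by apply: (@sum_rel_mul_le P (fun _ _ => true)) => // p; rewrite ler_nat max_card.
Qed.

Lemma sqr_normD3_le (x y t : C) :
  `|x + y + t| ^+ 2 <= 3%:R * (`|x| ^+ 2 + `|y| ^+ 2 + `|t| ^+ 2).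
Proof.
have := sqr_norm_sum_le (fun i : 'I_3 => nth 0 [:: x; y; t] i).
by rewrite card_ord !big_ord_recr !big_ord0 /= !add0r.
Qed.

Lemma norm_prim_rootX Q z k : Q.-primitive_root z -> `|z ^+ k| = 1.
Proof.
move=> zP; have Q0 := prim_order_gt0 zP.
suff z1 : `|z| = 1 by rewrite normrX z1 expr1n.
by apply/eqP; rewrite -(@pexpr_eq1 _ _ Q) // -normrX (prim_expr_order zP) normr1.
Qed.

Lemma prim_rootX_mulJ Q z k : Q.-primitive_root z -> z ^+ k * (z ^+ k)^* = 1.
Proof. by move=> zP; rewrite -normCK (norm_prim_rootX _ zP) expr1n. Qed.

Lemma conj_prim_root Q z : Q.-primitive_root z -> Q.-primitive_root z^*.
Proof. by move=> zP; rewrite fmorph_primitive_root. Qed.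

Lemma prim_rootX_subn Q z k : Q.-primitive_root z -> (k <= Q)%N ->
  z ^+ (Q - k) = z^* ^+ k.
Proof.
move=> zP kQ; rewrite -[LHS]mulr1 -(prim_rootX_mulJ k zP) mulrA -exprD subnK //.
by rewrite (prim_expr_order zP) mul1r rmorphXn.
Qed.

Lemma prim_order_natr_gt0 Q z : Q.-primitive_root z -> 0 < Q%:R :> C.
Proof. by move=> zP; rewrite ltr0n (prim_order_gt0 zP). Qed.

Lemma prim_root_ortho Q z a b : Q.-primitive_root z ->
  \sum_(x < Q) z ^+ (a * x) * (z ^+ (b * x))^* =
  if a == b %[mod Q] then Q%:R else 0.
Proof.
move=> zP; set u := z ^+ a * (z ^+ b)^*.
have uE (x : 'I_Q) : z ^+ (a * x) * (z ^+ (b * x))^* = u ^+ x.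
  by rewrite !exprM rmorphXn /= -exprMn.
rewrite (eq_bigr _ (fun x _ => uE x)) -(eq_prim_root_expr zP).
have uQ : u ^+ Q = 1.
  by rewrite exprMn -rmorphXn -!exprM mulnC [(b * _)%N]mulnC !exprM
    (prim_expr_order zP) !expr1n rmorph1 mulr1.
have [zab|zab] := eqVneq.
  rewrite /u zab (prim_rootX_mulJ _ zP).
  by rewrite (eq_bigr (fun=> 1)) ?sumr_const ?card_ord // => x _; rewrite expr1n.
have u1 : u - 1 != 0.
  apply: contra zab; rewrite subr_eq0 => /eqP u1.
  have := congr1 ( *%R^~ (z ^+ b)) u1.
  by rewrite /u -mulrA [_^* * _]mulrC (prim_rootX_mulJ _ zP) mulr1 mul1r => ->.
by apply: (mulfI u1); rewrite -subrX1 uQ subrr mulr0.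
Qed.

Lemma exp_sum_sqrE Q z (P : finType) (w : P -> C) (nu : P -> nat) :
  Q.-primitive_root z ->
  \sum_(x < Q) `|\sum_p w p * z ^+ (nu p * x)| ^+ 2 =
  Q%:R * \sum_p \sum_(q | nu p == nu q %[mod Q]) w p * (w q)^*.
Proof.
move=> zP; transitivity (\sum_p \sum_q w p * (w q)^* *
    \sum_(x < Q) z ^+ (nu p * x) * (z ^+ (nu q * x))^*).
  under eq_bigr do rewrite normCK rmorph_sum /= mulr_suml.
  rewrite exchange_big; apply: eq_bigr => p _ /=.
  under eq_bigr do rewrite mulr_sumr.
  rewrite exchange_big; apply: eq_bigr => q _ /=.
  by rewrite mulr_sumr; apply: eq_bigr => x _; rewrite rmorphM /= mulrACA.
rewrite mulr_sumr; apply: eq_bigr => p _.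
rewrite mulr_sumr [RHS]big_mkcond; apply: eq_bigr => q _ /=.
by rewrite (prim_root_ortho _ _ zP); case: ifP => _; rewrite ?mulr0 // mulrC.
Qed.

Lemma exp_sum_sqr_le Q z (P : finType) (w : P -> C) (nu : P -> nat) r :
  Q.-primitive_root z ->
  (forall p, #|[pred q | nu p == nu q %[mod Q]]|%:R <= r) ->
  \sum_(x < Q) `|\sum_p w p * z ^+ (nu p * x)| ^+ 2 <=
  Q%:R * (r * \sum_p `|w p| ^+ 2).
Proof.
move=> zP card_le.
rewrite -[leLHS]ger0_norm; last by apply: sumr_ge0 => x _; rewrite exprn_ge0.
rewrite (exp_sum_sqrE _ _ zP) normrM normr_nat ler_wpM2l ?ler0n //.
apply: le_trans (ler_norm_sum _ _ _) _.
have Esym : symmetric (fun p q => nu p == nu q %[mod Q]).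
  by move=> p q; rewrite eq_sym.
apply: le_trans (sum_rel_mul_le Esym (fun p => normr_ge0 (w p)) card_le).
apply: ler_sum => p _; apply: le_trans (ler_norm_sum _ _ _) _.
by apply: ler_sum => q _; rewrite normrM norm_conjC.
Qed.

(* Since H K < Q, the frequencies h k are distinct residues unless equal, so
   each of them is attained at most as often as it has divisors. *)
Lemma dilated_sum_sqr_le Q z H K r (w : 'I_H -> 'I_K -> C) :
  Q.-primitive_root z -> (H * K < Q)%N ->
  (forall n, (0 < n <= H * K)%N -> (size (divisors n))%:R <= r) ->
  \sum_(x < Q) `|\sum_h \sum_k w h k * z ^+ (h.+1 * k.+1 * x)| ^+ 2 <=
  Q%:R * (r * \sum_h \sum_k `|w h k| ^+ 2).
Proof.
move=> zP HKQ divr; rewrite [X in r * X]pair_bigA /=.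
under eq_bigr do rewrite pair_bigA /=.
apply: (exp_sum_sqr_le _ (nu := fun p : 'I_H * 'I_K => (p.1.+1 * p.2.+1)%N) zP).
have freq_le (p : 'I_H * 'I_K) : (0 < p.1.+1 * p.2.+1 <= H * K)%N by rewrite leq_mul.
have freq_lt (p : 'I_H * 'I_K) : (p.1.+1 * p.2.+1 < Q)%N.
  by apply: leq_ltn_trans HKQ; rewrite leq_mul.
move=> p; apply: le_trans (divr _ (freq_le p)); have /andP[n0 _] := freq_le p.
rewrite ler_nat; apply: leq_trans (card_factorizations_le _ _ n0).
by apply/subset_leq_card/subsetP => q; rewrite !inE !modn_small ?freq_lt // eq_sym.
Qed.

Section DiscreteFourierTransform.
Context (Q : nat) (z : C) (zP : Q.-primitive_root z).
Implicit Types G : nat -> C.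

Let Q_gt0 : 0 < Q%:R :> C := prim_order_natr_gt0 zP.

Definition dft G (k : nat) : C := average Q (fun x => G x * (z ^+ (k * x))^*).

Lemma dft0 G : dft G 0 = average Q G.
Proof. by congr (_ * _); apply: eq_bigr => x _; rewrite mul0n expr0 rmorph1 mulr1. Qed.

Lemma dft_inversion G x : (forall y, G (y %% Q)%N = G y) ->
  G x = \sum_(k < Q) dft G k * z ^+ (k * x).
Proof.
move=> Gper; have Q0 := prim_order_gt0 zP.
transitivity (Q%:R^-1 * \sum_(y < Q) G y *
    \sum_(k < Q) z ^+ (x * k) * (z ^+ (y * k))^*); last first.
  rewrite mulr_sumr; under eq_bigr do rewrite mulr_sumr mulr_sumr.
  rewrite exchange_big; apply: eq_bigr => k _ /=.
  rewrite /dft /average -mulrA mulr_suml mulr_sumr; apply: eq_bigr => y _.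
  by rewrite -mulrA [z ^+ (x * k) * _]mulrC [(k * y)%N]mulnC [(k * x)%N]mulnC.
under eq_bigr do rewrite (prim_root_ortho _ _ zP).
rewrite (bigD1 (Ordinal (ltn_pmod x Q0))) //= big1 => [|y ynx]; last first.
  rewrite ifN ?mulr0 //; apply: contra ynx => /eqP xy.
  by apply/eqP/val_inj; rewrite /= xy modn_small.
by rewrite modn_mod eqxx addr0 Gper mulrC mulfK // gt_eqF.
Qed.

Lemma dft_parseval G : \sum_(k < Q) `|dft G k| ^+ 2 = average Q (fun x => `|G x| ^+ 2).
Proof.
have plancherel : \sum_(k < Q) `|\sum_(x < Q) G x * z^* ^+ (x * k)| ^+ 2 =
    Q%:R * \sum_(x < Q) `|G x| ^+ 2.
  rewrite (exp_sum_sqrE (fun x : 'I_Q => G x) _ (conj_prim_root zP)); congr (_ * _).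
  apply: eq_bigr => x _; rewrite (big_pred1 x) => [|y]; first by rewrite normCK.
  by rewrite !modn_small //= eq_sym.
transitivity (Q%:R^-1 ^+ 2 * \sum_(k < Q) `|\sum_(x < Q) G x * z^* ^+ (x * k)| ^+ 2).
  rewrite mulr_sumr; apply: eq_bigr => k _.
  rewrite normrM exprMn normfV normr_nat; congr (_ * `|_| ^+ 2).
  by apply: eq_bigr => x _; rewrite rmorphXn mulnC.
by rewrite plancherel expr2 -mulrA mulKf // gt_eqF.
Qed.

Lemma dft_shift G k : G Q = G 0%N ->
  dft (fun x => G x.+1 - G x) k = dft G k * (z ^+ k - 1).
Proof.
move=> GQ; rewrite /dft /average -mulrA; congr (_ * _); rewrite mulrBr mulr1.
rewrite -[X in X * _](sum_periodic_succ (G := fun x => G x * (z ^+ (k * x))^*)) /=;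
  last by rewrite muln0 mulnC exprM (prim_expr_order zP) expr1n GQ.
rewrite mulr_suml -sumrB; apply: eq_bigr => x _; rewrite mulrBl; congr (_ - _).
rewrite mulnS exprD rmorphM /= mulrA mulrAC -[_ * z ^+ k]mulrA [_^* * z ^+ k]mulrC.
by rewrite (prim_rootX_mulJ _ zP) mulr1.
Qed.

Lemma dft_tail_sqr_le G (lam kap : C) (D : pred 'I_Q) :
  G Q = G 0%N -> 0 < kap ->
  (forall x, `|G x.+1 - G x| <= lam) -> (forall k, D k -> kap <= `|z ^+ k - 1|) ->
  \sum_(k < Q | D k) `|dft G k| ^+ 2 <= (lam / kap) ^+ 2.
Proof.
move=> GQ kap0 Glip Dkap; have lam0 : 0 <= lam by apply: le_trans (Glip 0%N).
rewrite expr_div_n ler_pdivlMr ?exprn_gt0 // mulr_suml.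
apply: (@le_trans _ _ (\sum_(k < Q) `|dft (fun x => G x.+1 - G x) k| ^+ 2)).
  rewrite [leLHS]big_mkcond; apply: ler_sum => k _.
  case: ifP => [Dk|_]; last by rewrite exprn_ge0.
  rewrite (dft_shift _ GQ); move: (dft G k) => c.
  rewrite normrM exprMn ler_wpM2l ?exprn_ge0 //.
  by rewrite lerXn2r ?nnegrE ?(ltW kap0) ?Dkap.
rewrite dft_parseval /average mulrC ler_pdivrMr // -[X in _ * X%:R]card_ord mulr_natr.
rewrite -sumr_const; apply: ler_sum => x _.
by rewrite lerXn2r ?nnegrE.
Qed.

Lemma dft_tail_sum_sqr_le G (lam kap : C) (D : pred 'I_Q) y :
  G Q = G 0%N -> 0 < kap ->
  (forall x, `|G x.+1 - G x| <= lam) -> (forall k, D k -> kap <= `|z ^+ k - 1|) ->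
  `|\sum_(k < Q | D k) dft G k * z ^+ (k * y)| ^+ 2 <= Q%:R * (lam / kap) ^+ 2.
Proof.
move=> GQ kap0 Glip Dkap; rewrite big_mkcond.
apply: (le_trans (sqr_norm_sum_le _)); rewrite card_ord ler_wpM2l ?(ltW Q_gt0) //.
apply: le_trans (dft_tail_sqr_le GQ kap0 Glip Dkap).
rewrite [leRHS]big_mkcond; apply: ler_sum => k _.
case: ifP => _; last by rewrite normr0 expr0n.
by rewrite normrM (norm_prim_rootX _ zP) mulr1.
Qed.

Lemma dft_energy_le_average G : (forall x, 0 <= G x <= 1) ->
  \sum_(k < Q) `|dft G k| ^+ 2 <= average Q G.
Proof.
move=> G01; rewrite dft_parseval ler_wpM2l ?invr_ge0 ?(ltW Q_gt0) //.
apply: ler_sum => x _; have /andP[G0 G1] := G01 x.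
by rewrite ger0_norm // expr2 ler_piMr.
Qed.

Lemma sub_average_dft_split G K y : (2 * K < Q)%N -> (forall y, G (y %% Q)%N = G y) ->
  G y - average Q G = \sum_(k < K) dft G k.+1 * z ^+ (k.+1 * y) +
    \sum_(k < K) dft G (Q - k.+1) * z^* ^+ (k.+1 * y) +
    \sum_(k < Q | (K < k < Q - K)%N) dft G k * z ^+ (k * y).
Proof.
move=> KQ Gper; rewrite {1}(dft_inversion _ Gper).
rewrite (sum_frequencies_split (fun k => dft G k * z ^+ (k * y)) KQ).
rewrite mul0n expr0 mulr1 dft0; apply/eqP; rewrite subr_eq; apply/eqP.
rewrite [RHS]addrC !addrA; congr (_ + _ + _ + _); apply: eq_bigr => k _.
by rewrite exprM (prim_rootX_subn zP) -?exprM //; have := ltn_ord k; lia.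
Qed.

Lemma dft_low_energy_le_average G K : (2 * K < Q)%N -> (forall x, 0 <= G x <= 1) ->
  \sum_(k < K) `|dft G k.+1| ^+ 2 + \sum_(k < K) `|dft G (Q - k.+1)| ^+ 2 <= average Q G.
Proof.
move=> KQ G01; apply: le_trans (dft_energy_le_average G01).
rewrite (sum_frequencies_split (fun k => `|dft G k| ^+ 2) KQ) -[leLHS]addr0.
apply: lerD; last by apply: sumr_ge0 => k _; rewrite exprn_ge0.
by rewrite -addrA lerDr exprn_ge0.
Qed.

End DiscreteFourierTransform.

(* The frequencies 0 < k <= K and Q - K <= k < Q contribute through
   dilated_sum_sqr_le, applied to z and to its conjugate. *)
Theorem dilation_variance_le Q K H r z (G : 'I_H -> nat -> C) (lam kap : C) :
  Q.-primitive_root z ->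
  (forall h y, G h (y %% Q)%N = G h y) -> (forall h x, 0 <= G h x <= 1) ->
  (forall h x, `|G h x.+1 - G h x| <= lam) ->
  0 < kap -> (forall k, (K < k < Q - K)%N -> kap <= `|z ^+ k - 1|) ->
  (2 * K < Q)%N -> (H * K < Q)%N ->
  0 <= r -> (forall n, (0 < n <= H * K)%N -> (size (divisors n))%:R <= r) ->
  \sum_(x < Q) `|\sum_h (G h (h.+1 * x)%N - average Q (G h))| ^+ 2 <=
  3%:R * (Q%:R * (r * \sum_h average Q (G h) + H%:R ^+ 2 * (Q%:R * (lam / kap) ^+ 2))).
Proof.
move=> zP Gper G01 Glip kap0 zkap KQ HKQ r0 divr.
pose c h := dft Q z (G h).
pose low_pos x := \sum_h \sum_(k < K) c h k.+1 * z ^+ (h.+1 * k.+1 * x).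
pose low_neg x := \sum_h \sum_(k < K) c h (Q - k.+1)%N * z^* ^+ (h.+1 * k.+1 * x).
pose high x :=
  \sum_(h < H) \sum_(k < Q | (K < k < Q - K)%N) c h k * z ^+ (k * (h.+1 * x)).
have splitting x :
    \sum_h (G h (h.+1 * x)%N - average Q (G h)) = low_pos x + low_neg x + high x.
  rewrite -!big_split; apply: eq_bigr => h _ /=.
  rewrite (sub_average_dft_split zP _ KQ (Gper h)).
  by congr (_ + _ + _); apply: eq_bigr => k _; rewrite mulnA [(k.+1 * _)%N]mulnC.
have high_le x : `|high x| ^+ 2 <= H%:R ^+ 2 * (Q%:R * (lam / kap) ^+ 2).
  apply: (le_trans (sqr_norm_sum_le _)).
  rewrite card_ord expr2 -mulrA ler_wpM2l ?ler0n // mulr_natl.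
  rewrite -[X in _ *+ X]card_ord -sumr_const; apply: ler_sum => h _.
  apply: (dft_tail_sum_sqr_le zP _ _ kap0 (Glip h)); last by move=> k; apply: zkap.
  by rewrite -(Gper h Q) modnn.
have energy : \sum_h \sum_(k < K) `|c h k.+1| ^+ 2 +
    \sum_h \sum_(k < K) `|c h (Q - k.+1)%N| ^+ 2 <= \sum_h average Q (G h).
  by rewrite -big_split; apply: ler_sum => h _; apply: dft_low_energy_le_average.
under eq_bigr do rewrite splitting.
apply: (le_trans (ler_sum _ (fun x _ => sqr_normD3_le _ _ _))).
rewrite -mulr_sumr ler_wpM2l ?ler0n // !big_split mulrDr; apply: lerD => /=.
  apply: le_trans (_ : Q%:R * (r * _) + Q%:R * (r * _) <= _); last first.
    by rewrite -!mulrDr; apply: ler_wpM2l (ler_wpM2l r0 energy); rewrite ler0n.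
  by apply: lerD; apply: dilated_sum_sqr_le => //; apply: conj_prim_root.
rewrite [leRHS]mulr_natl -[X in _ *+ X]card_ord -sumr_const.
by apply: ler_sum => x _; apply: high_le.
Qed.

End Fourier.
End FiniteFourier.

Definition grid_average (Q : nat) (g : nat -> R) : R := ssum g Q / INR Q.

Definition divisor_count_le (Q : nat) (r : R) : Prop :=
  forall n, (0 < n <= Q)%nat -> INR (seq.size (prime.divisors n)) <= r.

Lemma third_le_sin x : 0 <= x <= PI / 2 -> x / 3 <= sin x.
Proof.
intros Hx. pose proof PI_4.
destruct (sin_bound x 0) as [Hs _]; [lra | lra |].
unfold sin_approx, sin_term in Hs; simpl in Hs.
nra.
Qed.

Lemma sin_PI_frac_ge (Q K k : nat) : (0 < Q)%nat -> (K <= k <= Q - K)%nat ->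
  INR K / INR Q <= 2 * sin (PI * (INR k / INR Q)).
Proof.
intros HQ Hk. apply lt_0_INR in HQ as HQR. pose proof PI2_1.
assert (Hhalf : forall j, (K <= j)%nat -> (2 * j <= Q)%nat ->
   INR K / INR Q <= 2 * sin (PI * (INR j / INR Q))).
{ intros j HKj HjQ. apply le_INR in HKj, HjQ. rewrite mult_INR in HjQ; simpl in HjQ.
  assert (HjQ' : INR j / INR Q <= / 2) by (apply Rle_div_l; lra).
  assert (HKj' : INR K / INR Q <= INR j / INR Q).
  { apply Rmult_le_compat_r; [left; now apply Rinv_0_lt_compat | exact HKj]. }
  assert (0 <= INR K / INR Q) by (apply Rdiv_le_0_compat; [apply pos_INR | exact HQR]).
  pose proof (third_le_sin (PI * (INR j / INR Q))). nra. }
destruct (Nat.le_gt_cases (2 * k) Q); [apply Hhalf; lia|].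
rewrite <- sin_PI_x.
replace (PI - PI * (INR k / INR Q)) with (PI * (INR (Q - k) / INR Q)).
- apply Hhalf; lia.
- rewrite minus_INR by lia. field. lra.
Qed.

Lemma chord_length t : 0 <= sin t ->
  sqrt ((cos (2 * t) - 1) ^ 2 + sin (2 * t) ^ 2) = 2 * sin t.
Proof.
intros Ht. rewrite <- (sqrt_pow2 (2 * sin t)) by lra. f_equal.
rewrite cos_2a_sin, sin_2a.
replace ((2 * sin t * cos t) ^ 2) with (4 * (sin t) ^ 2 * (cos t * cos t)) by ring.
replace (cos t * cos t) with (1 - sin t * sin t); [ring|].
pose proof (sin2_cos2 t). unfold Rsqr in *. lra.
Qed.

Module GridDilation.
Import all_boot all_order all_algebra complex Rstruct.
Import Order.TTheory GRing.Theory Num.Theory.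
Import FiniteFourier.
Set Implicit Arguments.
Unset Strict Implicit.
Local Open Scope ring_scope.
Local Open Scope complex_scope.

Definition grid_root (Q : nat) : R[i] :=
  cos (2 * PI / INR Q)%coqR +i* sin (2 * PI / INR Q)%coqR.

Lemma grid_rootX Q k : grid_root Q ^+ k =
  cos (INR k * (2 * PI / INR Q))%coqR +i* sin (INR k * (2 * PI / INR Q))%coqR.
Proof.
elim: k => [|k IH]; first by rewrite expr0 /= Rmult_0_l cos_0 sin_0.
rewrite exprSr IH S_INR Rmult_plus_distr_r Rmult_1_l /grid_root cos_plus sin_plus.
by apply/eqP; rewrite eq_complex /=; apply/andP; split; apply/eqP;
  rewrite !(RmultE, RplusE, RminusE) // addrC.
Qed.

Lemma norm_grid_rootX_sub1_ge Q K k : (0 < Q)%N -> (K <= k <= Q - K)%N ->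
  (K%:R / Q%:R)%:C <= `|grid_root Q ^+ k - 1|.
Proof.
move=> /ssrnat.ltP Q0 /andP[/ssrnat.leP Kk /ssrnat.leP kQ].
have sin_ge := @sin_PI_frac_ge Q K k Q0 (conj Kk kQ).
rewrite grid_rootX normc_def lecR -!INRE -RdivE -RsqrtE; apply/RleP.
have -> : (INR k * (2 * PI / INR Q) = 2 * (PI * (INR k / INR Q)))%coqR.
  by rewrite /Rdiv; ring.
rewrite /= subr0 -!RpowE -RplusE -RminusE chord_length //.
by have := Rdiv_le_0_compat (INR K) (INR Q) (pos_INR K) (lt_0_INR Q Q0); lra.
Qed.

Lemma grid_root_prim Q : (0 < Q)%N -> Q.-primitive_root (grid_root Q).
Proof.
move=> Q0; apply/andP; split=> //; apply/forallP => i.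
rewrite unity_rootE; apply/eqP; have [->|iQ] := eqVneq i.+1 Q.
  rewrite grid_rootX.
  have -> : (INR Q * (2 * PI / INR Q))%coqR = (2 * PI)%coqR.
    by field; apply: not_0_INR; case: (Q) Q0.
  by rewrite cos_2PI sin_2PI; apply/eqP.
apply/negbTE/negP => /eqP root1.
have iQ1 : (1 <= i.+1 <= Q - 1)%N.
  by rewrite leq_subRL // add1n /= ltn_neqAle iQ ltn_ord.
have := norm_grid_rootX_sub1_ge Q0 iQ1.
by rewrite root1 subrr normr0 lecR leNgt divr_gt0 ?ltr0n.
Qed.

Lemma ssumE (f : nat -> R) n : ssum f n = \sum_(i < n) f i.+1.
Proof. by elim: n => [|n IH]; rewrite ?big_ord0 // big_ord_recr /= -IH. Qed.

Lemma grid_averageE Q g : g Q = g 0%N -> grid_average Q g = average Q g.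
Proof.
by move=> gQ; rewrite /grid_average /average RdivE INRE mulrC ssumE (sum_periodic_succ gQ).
Qed.

Theorem real_dilation_variance_le (Q K H : nat) (G : 'I_H -> nat -> R) (lam r : R) :
  (0 < K)%N -> (2 * K < Q)%N -> (H * K < Q)%N ->
  (forall h y, G h (y %% Q)%N = G h y) -> (forall h x, 0 <= G h x <= 1) ->
  (forall h x, `|G h x.+1 - G h x| <= lam) ->
  0 <= r -> (forall n, (0 < n <= H * K)%N -> (size (divisors n))%:R <= r) ->
  \sum_(x < Q) (\sum_h (G h (h.+1 * x)%N - average Q (G h))) ^+ 2 <=
  3%:R * (Q%:R * (r * \sum_h average Q (G h) +
    H%:R ^+ 2 * (Q%:R * (lam / (K%:R / Q%:R)) ^+ 2))).
Proof.
move=> K0 KQ HKQ Gper G01 Glip r0 divr.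
have Q0 : (0 < Q)%N by apply: leq_ltn_trans KQ.
have kap0 : 0 < (K%:R / Q%:R : R)%:C by rewrite ltcR divr_gt0 ?ltr0n.
have root_far k : (K < k < Q - K)%N -> (K%:R / Q%:R)%:C <= `|grid_root Q ^+ k - 1|.
  by move=> /andP[Kk kQ]; apply: norm_grid_rootX_sub1_ge; rewrite // ltnW // ltnW.
have Gper' h y : (G h (y %% Q)%N)%:C = (G h y)%:C by rewrite Gper.
have G01' h x : 0 <= (G h x)%:C <= 1.
  by have /andP[G0 G1] := G01 h x; rewrite ler0c G0 -[1]/(1%:C) lecR.
have Glip' h x : `|(G h x.+1)%:C - (G h x)%:C| <= lam%:C.
  by rewrite -rmorphB /= normc_def /= expr0n addr0 sqrtr_sqr lecR.
have r0' : 0 <= r%:C by rewrite ler0c.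
have divr' n : (0 < n <= H * K)%N -> (size (divisors n))%:R <= r%:C.
  by move=> /divr; rewrite -lecR rmorph_nat.
have averageC h : average Q (fun x => (G h x)%:C) = (average Q (G h))%:C.
  by rewrite /average rmorphM fmorphV rmorph_nat rmorph_sum.
have := dilation_variance_le (grid_root_prim Q0) Gper' G01' Glip' kap0 root_far KQ HKQ
  r0' divr'.
under [X in r%:C * X]eq_bigr do rewrite averageC.
rewrite -lecR !(rmorphD, rmorphM, rmorphXn, fmorphV, rmorph_nat, rmorph_sum) /=.
apply: le_trans; rewrite le_eqVlt; apply/orP; left; apply/eqP.
apply: eq_bigr => x _.
have -> : \sum_h ((G h (h.+1 * x)%N)%:C - average Q (fun y => (G h y)%:C)) =
    (\sum_h (G h (h.+1 * x)%N - average Q (G h)))%:C.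
  by rewrite rmorph_sum; apply: eq_bigr => h _; rewrite averageC rmorphB.
rewrite rmorphXn -normrX -rmorphXn normc_def /= expr0n addr0 sqrtr_sqr.
by rewrite ger0_norm ?sqr_ge0.
Qed.

(* Chebyshev's inequality: where every term vanishes, the sum is off its mean by mu. *)
Theorem few_annihilated_points (Q K H : nat) (G : nat -> nat -> R) (lam mu r : R) :
  (0 < K)%coq_nat -> (2 * K < Q)%coq_nat -> (H * K < Q)%coq_nat ->
  (forall h y, G h (y + Q)%coq_nat = G h y) -> (forall h x, (0 <= G h x <= 1)%coqR) ->
  (forall h x, (Rabs (G h (S x) - G h x) <= lam)%coqR) ->
  (0 <= r)%coqR -> divisor_count_le (H * K) r ->
  mu = ssum (fun h => grid_average Q (G h)) H ->
  exists l : list nat,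
    (forall x, (x < Q)%coq_nat ->
      (forall h, (1 <= h)%coq_nat -> (h <= H)%coq_nat -> G h (h * x)%coq_nat = 0%coqR) ->
      In x l) /\
    (INR (length l) * mu ^ 2 <=
     3 * (INR Q * (r * mu + INR H ^ 2 * (INR Q * (lam / (INR K / INR Q)) ^ 2))))%coqR.
Proof.
move=> /ssrnat.ltP K0 /ssrnat.ltP KQ /ssrnat.ltP HKQ Gper G01 Glip /RleP r0 divr ->.
have Gmod h y : G h (y %% Q)%N = G h y.
  rewrite [in RHS](divn_eq y Q); elim: (y %/ Q)%N => [|n IH] //.
  by rewrite mulSn -addnA addnC -plusE Gper.
have G01' h x : 0 <= G h x <= 1.
  by have [/RleP G0 /RleP G1] := G01 h x; rewrite G0.
have Glip' h x : `|G h x.+1 - G h x| <= lam by have /RleP := Glip h x; rewrite RabsE.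
have divr' n : (0 < n <= H * K)%N -> (size (divisors n))%:R <= r.
  by move=> /andP[/ssrnat.ltP n0 /ssrnat.leP nHK]; rewrite -INRE; apply/RleP/(divr n).
have muE : ssum (fun h => grid_average Q (G h)) H = \sum_(h < H) average Q (G h.+1).
  rewrite ssumE; apply: eq_bigr => h _; rewrite grid_averageE //.
  by rewrite -(Gmod _ Q) modnn.
have variance := real_dilation_variance_le K0 KQ HKQ (fun h => Gmod h.+1)
  (fun h => G01' h.+1) (fun h => Glip' h.+1) r0 divr'.
pose bad := [set x : 'I_Q | [forall h : 'I_H, G h.+1 (h.+1 * x)%N == 0]].
exists (map val (enum bad)); split.
  move=> x /ssrnat.ltP xQ x_bad.
  suff : x \in map val (enum bad).
    by elim: (map _ _) => // y l IH; rewrite inE => /predU1P[->|/IH]; [left|right].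
  apply/mapP; exists (Ordinal xQ) => //; rewrite mem_enum inE.
  apply/forallP => h; apply/eqP; apply: x_bad; [exact/ssrnat.leP | exact/ssrnat.leP/ltn_ord].
apply/RleP.
have three : IZR 3 = 3%:R :> R by rewrite -INRE INR_IZR_INZ.
rewrite !RpowE !(RmultE, RplusE, RdivE) !INRE muE three.
apply: le_trans variance.
have -> : length [seq \val i | i <- enum bad] = #|bad|.
  by rewrite -[length _]/(size _) size_map -cardE.
rewrite mulr_natl -sumr_const big_mkcond /=; apply: ler_sum => x _.
case: ifP => [|_]; last exact: sqr_ge0.
rewrite inE => /forallP x_bad.
under [X in _ <= X ^+ 2]eq_bigr do rewrite (eqP (x_bad _)) sub0r.
by rewrite sumrN sqrrN.
Qed.
End GridDilation.

(** * Koksma's inequality and exponential sums *)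

Import Coquelicot.

Lemma ssum_ext f g n : (forall k, (1 <= k <= n)%nat -> f k = g k) -> ssum f n = ssum g n.
Proof.
induction n as [|n IH]; intros H; simpl; [reflexivity|].
rewrite IH, H; [reflexivity | lia |]. intros k Hk; apply H; lia.
Qed.

Lemma ssum_le f g n : (forall k, (1 <= k <= n)%nat -> f k <= g k) -> ssum f n <= ssum g n.
Proof.
induction n as [|n IH]; intros H; simpl; [lra|].
apply Rplus_le_compat; [apply IH; intros k Hk; apply H; lia | apply H; lia].
Qed.

Lemma ssum_plus f g n : ssum (fun k => f k + g k) n = ssum f n + ssum g n.
Proof. induction n as [|n IH]; simpl; [|rewrite IH]; ring. Qed.

Lemma ssum_scal c f n : ssum (fun k => c * f k) n = c * ssum f n.
Proof. induction n as [|n IH]; simpl; [|rewrite IH]; ring. Qed.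

Lemma ssum_const c n : ssum (fun _ => c) n = INR n * c.
Proof. induction n as [|n IH]; [simpl; ring|]. rewrite S_INR; simpl; rewrite IH; ring. Qed.

Lemma ssum_exchange (F : nat -> nat -> R) m n :
  ssum (fun i => ssum (fun j => F i j) n) m = ssum (fun j => ssum (fun i => F i j) m) n.
Proof.
induction m as [|m IH]; simpl; [rewrite ssum_const; ring|].
now rewrite IH, ssum_plus.
Qed.

Lemma count_deviation_le_discrepancy x N t : (0 < N)%nat -> (forall n, 0 <= x n) ->
  0 <= t <= 1 -> Rabs (INR (count_in x 0 t N) - INR N * t) <= INR N * discrepancy x N.
Proof.
intros HN Hx Ht. assert (HNR : 0 < INR N) by (apply lt_0_INR; lia).
unfold discrepancy; destruct (completeness _ _ _) as [D HD]; simpl; destruct HD as [HD _].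
destruct (Rle_lt_or_eq_dec 0 t (proj1 Ht)) as [H0|<-].
- replace (INR (count_in x 0 t N) - INR N * t)
    with (INR N * (INR (count_in x 0 t N) / INR N - (t - 0))) by (field; lra).
  rewrite Rabs_mult, (Rabs_pos_eq (INR N)) by lra.
  apply Rmult_le_compat_l; [lra|]. apply HD. exists 0, t. repeat split; lra.
- assert (Hempty : count_in x 0 0 N = 0%nat).
  { clear -Hx. induction N as [|n IH]; simpl; [reflexivity|]. rewrite IH.
    destruct (Rle_dec 0 (x (S n))); [|reflexivity].
    destruct (Rlt_dec (x (S n)) 0); [|reflexivity]. specialize (Hx (S n)); lra. }
  rewrite Hempty. simpl. rewrite Rmult_0_r, Rminus_0_r, Rabs_R0.
  apply Rmult_le_pos; [lra|].
  eapply Rle_trans; [apply Rabs_pos|apply HD]. exists 0, 1. repeat split; lra.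
Qed.

Section KoksmaInequality.
Context (g g' : R -> R).
Context (g_deriv : forall t, is_derive g t (g' t)).
Context (g'_cont : forall t, continuous g' t).

Lemma is_RInt_deriv_indicator y : 0 <= y < 1 ->
  is_RInt (fun t => if Rlt_dec y t then g' t else 0) 0 1 (g 1 - g y).
Proof.
intros [Hy0 Hy1]. rewrite <- (Rplus_0_l (g 1 - g y)).
apply (is_RInt_Chasles (V := R_NormedModule) _ 0 y 1).
- apply (is_RInt_ext (fun _ => 0)).
  + intros t Ht. rewrite Rmin_left, Rmax_right in Ht by lra.
    destruct (Rlt_dec y t); [lra|reflexivity].
  + evar_last; [apply (is_RInt_const 0 y 0) | apply Rmult_0_r].
- apply (is_RInt_ext g').
  + intros t Ht. rewrite Rmin_left, Rmax_right in Ht by lra.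
    destruct (Rlt_dec y t); [reflexivity|lra].
  + now apply (is_RInt_derive g g').
Qed.

Lemma is_RInt_deriv_count x n : (forall k, 0 <= x k < 1) ->
  is_RInt (fun t => g' t * INR (count_in x 0 t n)) 0 1
    (ssum (fun k => g 1 - g (x k)) n).
Proof.
intros Hx. induction n as [|n IH]; simpl.
- apply (is_RInt_ext (fun _ => 0)); [intros; simpl; ring|].
  evar_last; [apply (is_RInt_const 0 1 0) | apply Rmult_0_r].
- apply (is_RInt_ext (fun t => plus (g' t * INR (count_in x 0 t n))
     (if Rlt_dec (x (S n)) t then g' t else 0))).
  + intros t _. destruct (Hx (S n)) as [H0 _]. rewrite plus_INR.
    destruct (Rle_dec 0 (x (S n))); [|lra].
    destruct (Rlt_dec (x (S n)) t); unfold plus; simpl; ring.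
  + apply (is_RInt_plus _ _ _ _ _ _ IH), is_RInt_deriv_indicator, Hx.
Qed.

Lemma is_RInt_id_mul_deriv I : is_RInt g 0 1 I -> is_RInt (fun t => t * g' t) 0 1 (g 1 - I).
Proof.
intros Hg. apply (is_RInt_ext (fun t => minus (g t + t * g' t) (g t))).
{ intros t _. unfold minus, plus, opp; simpl; ring. }
replace (g 1 - I) with (minus (1 * g 1 - 0 * g 0) I)
  by (unfold minus, plus, opp; simpl; ring).
apply (is_RInt_minus (V := R_NormedModule)); [|exact Hg].
apply (is_RInt_derive (fun t => t * g t) (fun t => g t + t * g' t)).
- intros t _. evar_last.
  + apply (is_derive_mult (fun t => t) g t 1 (g' t));
      [apply (is_derive_id (K := R_AbsRing)) | apply g_deriv | intros; apply Rmult_comm].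
  + unfold plus, mult; simpl. unfold mult; simpl. ring.
- intros t _. apply (continuous_plus g).
  + apply ex_derive_continuous. exists (g' t); apply g_deriv.
  + apply (continuous_mult (fun t => t) g'); [apply continuous_id | apply g'_cont].
Qed.

(* Integration by parts against the counting function. *)
Theorem koksma x N M I : (0 < N)%nat -> (forall k, 0 <= x k < 1) ->
  is_RInt g 0 1 I -> (forall t, 0 <= t <= 1 -> Rabs (g' t) <= M) ->
  Rabs (ssum (fun k => g (x k)) N - INR N * I) <= M * (INR N * discrepancy x N).
Proof.
intros HN Hx Hg HM.
assert (Hparts : is_RInt (fun t => g' t * (INR (count_in x 0 t N) - INR N * t)) 0 1
   (- (ssum (fun k => g (x k)) N - INR N * I))).
{ apply (is_RInt_ext (fun t => minus (g' t * INR (count_in x 0 t N))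
     (scal (INR N) (t * g' t)))).
  { intros t _. unfold minus, plus, opp, scal; simpl. unfold mult; simpl. ring. }
  replace (- (ssum (fun k => g (x k)) N - INR N * I))
    with (minus (ssum (fun k => g 1 - g (x k)) N) (scal (INR N) (g 1 - I))).
  - apply (is_RInt_minus (V := R_NormedModule)); [exact (is_RInt_deriv_count x N Hx)|].
    exact (is_RInt_scal (V := R_NormedModule) _ _ _ (INR N) _ (is_RInt_id_mul_deriv I Hg)).
  - rewrite (ssum_ext _ (fun k => g 1 + -1 * g (x k))) by (intros; ring).
    rewrite ssum_plus, ssum_const, ssum_scal.
    unfold minus, plus, opp, scal; simpl. unfold mult; simpl. ring. }
rewrite <- Rabs_Ropp.
replace (M * (INR N * discrepancy x N))
  with ((1 - 0) * (M * (INR N * discrepancy x N))) by ring.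
apply (norm_RInt_le_const _ 0 1 _ _ Rle_0_1) with (2 := Hparts).
intros t Ht. change norm with Rabs. rewrite Rabs_mult.
apply Rmult_le_compat; try apply Rabs_pos; [now apply HM|].
apply count_deviation_le_discrepancy; [exact HN | intros; apply Hx | exact Ht].
Qed.
End KoksmaInequality.

Definition lipschitz (L : R) (f : R -> R) : Prop :=
  forall x y, Rabs (f x - f y) <= L * Rabs (x - y).

Lemma lipschitz_cos : lipschitz 1 cos.
Proof.
intros x y. destruct (MVT_gen cos y x (fun t => - sin t)) as [t [_ Ht]].
- intros t _. auto_derive; [trivial|ring].
- intros t _. apply continuity_cos.
- rewrite Ht, Rabs_mult, Rabs_Ropp. apply Rmult_le_compat_r; [apply Rabs_pos|].
  apply Rabs_le. pose proof (SIN_bound t). lra.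
Qed.

Lemma lipschitz_continuous L f x : lipschitz L f -> continuous f x.
Proof.
intros Hf. apply filterlim_locally. intros eps.
assert (HL : 0 < Rabs L + 1) by (pose proof (Rabs_pos L); lra).
exists (mkposreal (eps / (Rabs L + 1)) (Rdiv_lt_0_compat _ _ (cond_pos eps) HL)).
intros y Hy. change (Rabs (f y - f x) < eps).
change (Rabs (y - x) < eps / (Rabs L + 1)) in Hy. apply Rlt_div_r in Hy; [|lra].
pose proof (Hf y x). pose proof (Rle_abs L). pose proof (Rabs_pos (y - x)). nra.
Qed.

Lemma RInt_le_grid_average f L Q : (0 < Q)%nat -> lipschitz L f ->
  RInt f 0 1 <= grid_average Q (fun k => f (INR k / INR Q)) + L / INR Q.
Proof.
intros HQ Hf. assert (HQR : 0 < INR Q) by (apply lt_0_INR; lia).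
assert (HL : 0 <= L).
{ pose proof (Hf 1 0) as H. rewrite Rminus_0_r, Rabs_R1 in H.
  pose proof (Rabs_pos (f 1 - f 0)). lra. }
assert (Hex : forall u v, ex_RInt f u v).
{ intros u v. apply (ex_RInt_continuous (V := R_CompleteNormedModule)).
  intros t _. exact (lipschitz_continuous L f t Hf). }
assert (Hcell : forall j, RInt f (INR j / INR Q) (INR (S j) / INR Q) <=
   / INR Q * (f (INR (S j) / INR Q) + L / INR Q)).
{ intros j. pose proof (Rinv_0_lt_compat _ HQR).
  assert (HS : INR (S j) / INR Q = INR j / INR Q + / INR Q) by (rewrite S_INR; field; lra).
  set (u := INR j / INR Q) in *. set (v := INR (S j) / INR Q) in *.
  replace (/ INR Q * (f v + L / INR Q)) with (RInt (fun _ => f v + L / INR Q) u v).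
  - apply RInt_le; [lra | apply Hex | apply ex_RInt_const |]. intros t Ht.
    pose proof (Hf t v) as Hlip. rewrite (Rabs_left1 (t - v)) in Hlip by lra.
    pose proof (Rle_abs (f t - f v)).
    assert (L * - (t - v) <= L * / INR Q) by (apply Rmult_le_compat_l; lra).
    unfold Rdiv. lra.
  - rewrite RInt_const, HS. unfold scal; simpl. unfold mult; simpl. ring. }
assert (Hprefix : forall j, RInt f 0 (INR j / INR Q) <=
  / INR Q * (ssum (fun k => f (INR k / INR Q)) j + INR j * (L / INR Q))).
{ induction j as [|j IH].
  - simpl. unfold Rdiv. rewrite !Rmult_0_l, RInt_point. unfold zero; simpl. lra.
  - rewrite <- (RInt_Chasles f 0 (INR j / INR Q)) by apply Hex.
    eapply Rle_trans; [apply Rplus_le_compat; [exact IH | apply Hcell]|].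
    cbn [ssum]. rewrite (S_INR j) at 3. right; ring. }
specialize (Hprefix Q). rewrite Rdiv_diag in Hprefix by lra. unfold grid_average.
eapply Rle_trans; [exact Hprefix|]. right. field. lra.
Qed.

Lemma cos_add_2PI_Z x z : cos (x + 2 * IZR z * PI) = cos x.
Proof.
destruct (Z_le_gt_dec 0 z).
- rewrite <- (Z2Nat.id z), <- INR_IZR_INZ by assumption. apply cos_period.
- rewrite <- (cos_period _ (Z.to_nat (- z))), INR_IZR_INZ, Z2Nat.id, opp_IZR by lia.
  f_equal; ring.
Qed.

Lemma polar_coordinates x y : exists t,
  x = sqrt (x ^ 2 + y ^ 2) * cos t /\ y = sqrt (x ^ 2 + y ^ 2) * sin t.
Proof.
set (r := sqrt (x ^ 2 + y ^ 2)).
assert (Hr2 : r * r = x ^ 2 + y ^ 2) by (apply sqrt_sqrt; nra).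
destruct (Req_dec r 0) as [Hr0|Hr0].
{ exists 0. rewrite Hr0 in *. split; nra. }
assert (Hr : 0 < r) by (pose proof (sqrt_pos (x ^ 2 + y ^ 2)); unfold r in *; lra).
assert (Hunit : (x / r)² + (y / r)² = 1).
{ unfold Rsqr. field_simplify_eq; nra. }
assert (Hcos : -1 <= x / r <= 1) by (pose proof (Rle_0_sqr (y / r)); unfold Rsqr in *; nra).
assert (Hsin : sin (acos (x / r)) = Rabs (y / r)).
{ rewrite sin_acos by exact Hcos. rewrite <- sqrt_Rsqr_abs. f_equal. lra. }
destruct (Rle_lt_dec 0 (y / r)) as [Hy|Hy].
- exists (acos (x / r)). rewrite cos_acos, Hsin, Rabs_pos_eq by assumption.
  split; field; exact Hr0.
- exists (- acos (x / r)). rewrite cos_neg, sin_neg, cos_acos, Hsin, Rabs_left by assumption.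
  split; field; exact Hr0.
Qed.

Lemma ssum_cos_shift phi N t :
  ssum (fun n => cos (phi n - t)) N =
  cos t * ssum (fun n => cos (phi n)) N + sin t * ssum (fun n => sin (phi n)) N.
Proof.
rewrite <- !ssum_scal, <- ssum_plus. apply ssum_ext. intros n _. rewrite cos_minus. ring.
Qed.

Section ExponentialSums.
Context (a : nat -> Z) (N : nat).

Lemma exp_sum_abs_phase alpha : exists t0, forall t,
  ssum (fun n => cos (2 * PI * IZR (a n) * alpha - t)) N = exp_sum_abs a N alpha * cos (t0 - t).
Proof.
unfold exp_sum_abs.
set (c := ssum (fun n => cos (2 * PI * IZR (a n) * alpha)) N).
set (s := ssum (fun n => sin (2 * PI * IZR (a n) * alpha)) N).
destruct (polar_coordinates c s) as [t0 [Hc Hs]]. exists t0. intros t.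
rewrite ssum_cos_shift, cos_minus. fold c s.
set (r := sqrt (c ^ 2 + s ^ 2)) in *. clearbody r. rewrite Hc, Hs. ring.
Qed.

Lemma ssum_cos_le_exp_sum_abs alpha t :
  ssum (fun n => cos (2 * PI * IZR (a n) * alpha - t)) N <= exp_sum_abs a N alpha.
Proof.
destruct (exp_sum_abs_phase alpha) as [t0 Ht0]. rewrite Ht0.
pose proof (COS_bound (t0 - t)). assert (0 <= exp_sum_abs a N alpha) by apply sqrt_pos. nra.
Qed.

Lemma exp_sum_abs_eq_ssum_cos alpha : exists t,
  exp_sum_abs a N alpha = ssum (fun n => cos (2 * PI * IZR (a n) * alpha - t)) N.
Proof.
destruct (exp_sum_abs_phase alpha) as [t0 Ht0]. exists t0.
rewrite Ht0, Rminus_diag, cos_0. ring.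
Qed.

Lemma exp_sum_abs_le alpha : exp_sum_abs a N alpha <= INR N.
Proof.
destruct (exp_sum_abs_eq_ssum_cos alpha) as [t ->].
rewrite <- (Rmult_1_r (INR N)), <- ssum_const. apply ssum_le. intros n _. apply COS_bound.
Qed.

Lemma exp_sum_abs_periodic alpha : exp_sum_abs a N (alpha + 1) = exp_sum_abs a N alpha.
Proof.
assert (Hcos : forall t, ssum (fun n => cos (2 * PI * IZR (a n) * (alpha + 1) - t)) N =
  ssum (fun n => cos (2 * PI * IZR (a n) * alpha - t)) N).
{ intros t. apply ssum_ext. intros n _.
  rewrite <- (cos_add_2PI_Z (2 * PI * IZR (a n) * alpha - t) (a n)). f_equal. ring. }
apply Rle_antisym.
- destruct (exp_sum_abs_eq_ssum_cos (alpha + 1)) as [t ->]. rewrite Hcos.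
  apply ssum_cos_le_exp_sum_abs.
- destruct (exp_sum_abs_eq_ssum_cos alpha) as [t ->]. rewrite <- Hcos.
  apply ssum_cos_le_exp_sum_abs.
Qed.

Lemma exp_sum_abs_lipschitz A : (forall n, (1 <= n <= N)%nat -> Rabs (IZR (a n)) <= A) ->
  lipschitz (2 * PI * INR N * A) (exp_sum_abs a N).
Proof.
intros HA. pose proof PI_RGT_0.
assert (Hle : forall x y,
  exp_sum_abs a N x <= exp_sum_abs a N y + 2 * PI * INR N * A * Rabs (x - y)).
{ intros x y. destruct (exp_sum_abs_eq_ssum_cos x) as [t ->].
  eapply Rle_trans; [|apply Rplus_le_compat_r, (ssum_cos_le_exp_sum_abs y t)].
  replace (2 * PI * INR N * A * Rabs (x - y))
    with (ssum (fun _ => 2 * PI * A * Rabs (x - y)) N) by (rewrite ssum_const; ring).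
  rewrite <- ssum_plus. apply ssum_le. intros n Hn.
  pose proof (lipschitz_cos (2 * PI * IZR (a n) * x - t) (2 * PI * IZR (a n) * y - t)) as Hcos.
  replace (2 * PI * IZR (a n) * x - t - (2 * PI * IZR (a n) * y - t))
    with (2 * PI * IZR (a n) * (x - y)) in Hcos by ring.
  rewrite !Rabs_mult, (Rabs_pos_eq 2), (Rabs_pos_eq PI) in Hcos by lra.
  assert (2 * PI * Rabs (IZR (a n)) * Rabs (x - y) <= 2 * PI * A * Rabs (x - y)).
  { apply Rmult_le_compat_r; [apply Rabs_pos|]. pose proof (HA n Hn). nra. }
  pose proof (Rle_abs (cos (2 * PI * IZR (a n) * x - t) - cos (2 * PI * IZR (a n) * y - t))).
  lra. }
intros x y. pose proof (Hle x y). pose proof (Hle y x) as Hyx.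
rewrite (Rabs_minus_sym y) in Hyx. apply Rabs_le. lra.
Qed.

Definition scaled_discrepancy (alpha : R) : R :=
  INR N * discrepancy (fun n => frac_part (IZR (a n) * alpha)) N.

Theorem exp_sum_abs_le_scaled_discrepancy h alpha : (0 < N)%nat -> (0 < h)%nat ->
  exp_sum_abs a N (INR h * alpha) <= 2 * PI * INR h * scaled_discrepancy alpha.
Proof.
intros HN Hh. destruct (exp_sum_abs_eq_ssum_cos (INR h * alpha)) as [t ->].
pose proof PI_RGT_0. apply lt_0_INR in Hh as HhR.
set (w := 2 * PI * INR h). assert (Hw : 0 < w) by (unfold w; nra).
set (x := fun n => frac_part (IZR (a n) * alpha)).
set (g := fun u => cos (w * u - t)).
rewrite (ssum_ext _ (fun n => g (x n))).
2:{ intros n _. unfold g.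
    rewrite <- (cos_add_2PI_Z (w * x n - t) (Z.of_nat h * Int_part (IZR (a n) * alpha))).
    f_equal. unfold w, x, frac_part. rewrite mult_IZR, <- INR_IZR_INZ. ring. }
assert (Hkoksma : Rabs (ssum (fun n => g (x n)) N - INR N * 0) <= w * (INR N * discrepancy x N)).
{ apply (koksma g (fun u => - w * sin (w * u - t))).
  - intros u. unfold g. auto_derive; [trivial | unfold Rminus; ring].
  - intros u. apply (ex_derive_continuous (V := R_NormedModule)). auto_derive. trivial.
  - exact HN.
  - intros k. destruct (base_fp (IZR (a k) * alpha)). unfold x; lra.
  - evar_last.
    + apply (is_RInt_derive (fun u => / w * sin (w * u - t)) g).
      * intros u _. unfold g. auto_derive; [trivial | unfold Rminus; field; lra].
      * intros u _. apply (ex_derive_continuous (V := R_NormedModule)).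
        unfold g. auto_derive. trivial.
    + unfold minus, plus, opp; simpl.
      replace (w * 1 - t) with (w * 0 - t + 2 * INR h * PI) by (unfold w; ring).
      rewrite sin_period. ring.
  - intros u _. rewrite Rabs_mult, Rabs_Ropp, (Rabs_pos_eq w) by lra.
    assert (Rabs (sin (w * u - t)) <= 1) by apply Rabs_le, SIN_bound. nra. }
rewrite Rmult_0_r, Rminus_0_r in Hkoksma.
eapply Rle_trans; [apply Rle_abs | exact Hkoksma].
Qed.
End ExponentialSums.

(** * Null sets *)

Definition interval_total (l : list (R * R)) : R :=
  fold_right (fun I s => (snd I - fst I) + s) 0 l.

Definition proper_intervals (l : list (R * R)) : Prop :=
  List.Forall (fun I => fst I <= snd I) l.

Definition content_zero (S : R -> Prop) : Prop :=
  forall eps, 0 < eps -> exists l, proper_intervals l /\ interval_total l <= eps /\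
    forall y, S y -> exists I, In I l /\ fst I < y < snd I.

Lemma interval_total_app l1 l2 :
  interval_total (l1 ++ l2) = interval_total l1 + interval_total l2.
Proof. induction l1 as [|I l IH]; simpl; [|rewrite IH]; ring. Qed.

Lemma interval_total_nonneg l : proper_intervals l -> 0 <= interval_total l.
Proof. induction 1; simpl; lra. Qed.

Lemma sum_nth_le_interval_total l n : proper_intervals l ->
  sum_f_R0 (fun k => snd (nth k l (0, 0)) - fst (nth k l (0, 0))) n <= interval_total l.
Proof.
intros Hl. revert n. induction Hl as [|I l HI Hl IH]; intros n.
- right. simpl. rewrite <- (sum_eq (fun _ => 0)).
  + rewrite sum_cte. ring.
  + intros [|k] _; simpl; ring.
- destruct n as [|n].
  + pose proof (interval_total_nonneg l Hl). simpl. lra.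
  + rewrite decomp_sum by lia. simpl. apply Rplus_le_compat_l, IH.
Qed.

(* The degenerate interval (0, 0) makes every block non-empty, so that a k-th
   interval already occurs among the first k + 1 blocks. *)
Section Concatenation.
Context (F : nat -> list (R * R)).

Definition blocks_upto (p : nat) : list (R * R) :=
  flat_map (fun q => (0, 0) :: F q) (seq 0 p).

Lemma blocks_upto_add p d :
  blocks_upto (p + d) = blocks_upto p ++ flat_map (fun q => (0, 0) :: F q) (seq p d).
Proof. unfold blocks_upto. now rewrite seq_app, flat_map_app. Qed.

Lemma length_blocks_upto p : (p <= length (blocks_upto p))%nat.
Proof.
induction p as [|p IH]; [simpl; lia|].
rewrite <- Nat.add_1_r, blocks_upto_add, length_app. simpl. lia.
Qed.

Lemma nth_blocks_upto k p q : (k < length (blocks_upto p))%nat -> (k < q)%nat ->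
  nth k (blocks_upto q) (0, 0) = nth k (blocks_upto p) (0, 0).
Proof.
intros Hp Hkq. pose proof (length_blocks_upto q).
destruct (Nat.le_ge_cases p q) as [Hpq|Hqp].
- replace q with (p + (q - p))%nat by lia. rewrite blocks_upto_add. now apply app_nth1.
- replace p with (q + (p - q))%nat by lia. rewrite blocks_upto_add. symmetry. apply app_nth1. lia.
Qed.

Lemma In_blocks_upto I p : In I (F p) -> In I (blocks_upto (S p)).
Proof. intros HI. apply in_flat_map. exists p. split; [apply in_seq; lia | now right]. Qed.

Lemma blocks_upto_proper p : (forall q, proper_intervals (F q)) ->
  proper_intervals (blocks_upto p).
Proof.
intros HF. apply Forall_flat_map, Forall_forall. intros q _.
constructor; [simpl; lra | apply HF].
Qed.

Lemma interval_total_blocks_upto eps p :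
  (forall q, interval_total (F q) <= eps * (/ 2) ^ S q) ->
  interval_total (blocks_upto p) <= eps * (1 - (/ 2) ^ p).
Proof.
intros HF. induction p as [|p IH]; [simpl; lra|].
rewrite <- (Nat.add_1_r p) at 1. rewrite blocks_upto_add, interval_total_app. simpl seq.
cbn [flat_map]. rewrite app_nil_r. cbn [interval_total fold_right fst snd].
specialize (HF p). unfold interval_total in *. simpl pow in *. lra.
Qed.
End Concatenation.

Theorem null_set_of_content_zero_cover (P : R -> Prop) (E : nat -> R -> Prop) :
  (forall y, P y -> exists p, E p y) -> (forall p, content_zero (E p)) -> null_set P.
Proof.
intros HP HE eps Heps.
destruct (functional_choice (fun p l => proper_intervals l /\
     interval_total l <= eps * (/ 2) ^ S p /\
     forall y, E p y -> exists I, In I l /\ fst I < y < snd I)) as [F HF].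
{ intros p. apply HE. apply Rmult_lt_0_compat; [exact Heps|]. apply pow_lt. lra. }
assert (Hproper : forall p, proper_intervals (blocks_upto F p)).
{ intros p. apply blocks_upto_proper. intros q. apply HF. }
set (e := fun k => nth k (blocks_upto F (S k)) (0, 0)).
assert (He : forall k p, (k < length (blocks_upto F p))%nat ->
  e k = nth k (blocks_upto F p) (0, 0)).
{ intros k p Hk. now apply nth_blocks_upto; [|lia]. }
exists (fun k => fst (e k)), (fun k => snd (e k)). repeat split.
- intros k. apply (proj1 (Forall_forall _ _) (Hproper (S k))), nth_In.
  pose proof (length_blocks_upto F (S k)). lia.
- intros n.
  rewrite (sum_eq _ (fun k => snd (nth k (blocks_upto F (S n)) (0, 0)) -
                              fst (nth k (blocks_upto F (S n)) (0, 0)))).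
  + eapply Rle_trans; [apply sum_nth_le_interval_total, Hproper|].
    eapply Rle_trans; [apply (interval_total_blocks_upto F eps); intros q; apply (HF q)|].
    assert (0 < (/ 2) ^ S n) by (apply pow_lt; lra). nra.
  + intros k Hk. rewrite (He k (S n)); [reflexivity|].
    pose proof (length_blocks_upto F (S n)). lia.
- intros y Hy. destruct (HP y Hy) as [p Hp].
  destruct (HF p) as [_ [_ Hcover]]. destruct (Hcover y Hp) as [I [HI Hy']].
  apply In_blocks_upto, In_nth with (d := (0, 0)) in HI. destruct HI as [k [Hk <-]].
  exists k. now rewrite (He k (S p)).
Qed.

(** * The exceptional set *)

Definition layer (h : nat) (u : R) : R := Rmax 0 (Rmin 1 (u - INR h)).

Lemma layer_bounds h u : 0 <= layer h u <= 1.
Proof.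
unfold layer. split; [apply Rmax_l|]. apply Rmax_lub; [lra|apply Rmin_l].
Qed.

Lemma layer_eq0 h u : u <= INR h -> layer h u = 0.
Proof. intros Hu. unfold layer. rewrite Rmin_right by lra. apply Rmax_left. lra. Qed.

Lemma lipschitz_layer h : lipschitz 1 (layer h).
Proof.
intros u v. unfold layer, Rmax, Rmin.
repeat (destruct (Rle_dec _ _)); unfold Rabs; repeat destruct (Rcase_abs _); lra.
Qed.

Lemma ssum_layer_ge u H : Rmin (u - 1) (INR H) <= ssum (fun h => layer h u) H.
Proof.
induction H as [|H IH]; [apply Rmin_r|].
cbn [ssum]. revert IH. unfold layer. rewrite S_INR. unfold Rmax, Rmin.
repeat (destruct (Rle_dec _ _)); lra.
Qed.

Lemma exists_frequency_cutoff Q H : (0 < H)%nat -> (4 * H <= Q)%nat ->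
  exists K, (0 < K)%nat /\ (2 * H * K < Q)%nat /\ (Q <= 4 * H * K)%nat.
Proof.
intros HH HQ. exists ((Q - 1) / (2 * H))%nat.
pose proof (Nat.div_mod_eq (Q - 1) (2 * H)).
pose proof (Nat.mod_upper_bound (Q - 1) (2 * H) ltac:(lia)).
set (K := ((Q - 1) / (2 * H))%nat) in *.
assert (0 < K)%nat by (destruct K; lia).
assert (H <= H * K)%nat by nia. lia.
Qed.

Lemma count_le_of_variance count mu q r H K L :
  0 < q -> 0 < H -> 0 < K -> q <= 4 * H * K -> 16 * H ^ 4 * L ^ 2 <= q ->
  1 <= r -> 1 <= mu ->
  count * mu ^ 2 <= 3 * (q * (r * mu + H ^ 2 * (q * (L / q / (K / q)) ^ 2))) ->
  count <= 6 * r * q / mu.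
Proof.
intros Hq HH HK HqK HqL Hr Hmu Hcount.
assert (Htail : H ^ 2 * (q * (L / q / (K / q)) ^ 2) <= 1).
{ replace (H ^ 2 * (q * (L / q / (K / q)) ^ 2)) with (q * (H ^ 2 * L ^ 2) / K ^ 2)
    by (field; lra).
  apply Rle_div_l; [now apply pow_lt|]. rewrite Rmult_1_l.
  apply Rmult_le_reg_r with (16 * H ^ 2); [nra|].
  apply Rle_trans with (q * q).
  - replace (q * (H ^ 2 * L ^ 2) * (16 * H ^ 2)) with (q * (16 * H ^ 4 * L ^ 2)) by ring.
    apply Rmult_le_compat_l; lra.
  - replace (K ^ 2 * (16 * H ^ 2)) with ((4 * H * K) * (4 * H * K)) by ring.
    apply Rmult_le_compat; lra. }
apply Rle_div_r; [lra|]. apply Rmult_le_reg_r with mu; [lra|].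
assert (1 <= r * mu) by nra.
assert (q * (r * mu + H ^ 2 * (q * (L / q / (K / q)) ^ 2)) <= q * (2 * (r * mu)))
  by (apply Rmult_le_compat_l; lra).
simpl pow in Hcount at 1. lra.
Qed.

Lemma grid_average_layers_ge f L V Q H : (0 < Q)%nat -> lipschitz L f ->
  L <= INR Q -> 1 <= V -> (forall x, f x <= INR H) ->
  RInt f 0 1 / V - 2 <=
  ssum (fun h => grid_average Q (fun x => layer h (f (INR x / INR Q) / V))) H.
Proof.
intros HQ Hf HLQ HV HfH. assert (Hq : 0 < INR Q) by (apply lt_0_INR; lia).
assert (Hfubini : ssum (fun h => grid_average Q (fun x => layer h (f (INR x / INR Q) / V))) H =
  grid_average Q (fun x => ssum (fun h => layer h (f (INR x / INR Q) / V)) H)).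
{ unfold grid_average, Rdiv at 1 4. rewrite ssum_exchange, Rmult_comm, <- ssum_scal.
  apply ssum_ext. intros h _. ring. }
rewrite Hfubini. unfold grid_average. apply Rle_div_r; [exact Hq|].
apply Rle_trans with (ssum (fun x => / V * f (INR x / INR Q) + -1) Q).
- pose proof (RInt_le_grid_average f L Q HQ Hf) as Hint. unfold grid_average in Hint.
  rewrite ssum_plus, ssum_scal, ssum_const.
  assert (Hle : RInt f 0 1 * INR Q <= ssum (fun x => f (INR x / INR Q)) Q + L).
  { apply Rle_div_r; [exact Hq|]. lra. }
  apply Rmult_le_compat_r with (r := / V) in Hle; [|left; apply Rinv_0_lt_compat; lra].
  assert (L * / V <= INR Q).
  { apply Rle_div_l; [lra|]. nra. }
  unfold Rdiv. lra.
- apply ssum_le. intros x _. eapply Rle_trans; [|apply ssum_layer_ge].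
  apply Rmin_glb; [unfold Rdiv; lra|].
  pose proof (HfH (INR x / INR Q)).
  assert (f (INR x / INR Q) / V <= INR H).
  { apply Rle_div_l; [lra|]. pose proof (pos_INR H). nra. }
  unfold Rdiv in *. lra.
Qed.

Lemma grid_layer_step_le f L V Q h x : (0 < Q)%nat -> lipschitz L f -> 1 <= V ->
  Rabs (layer h (f (INR (S x) / INR Q) / V) - layer h (f (INR x / INR Q) / V)) <= L / INR Q.
Proof.
intros HQ Hf HV. assert (Hq : 0 < INR Q) by (apply lt_0_INR; lia).
eapply Rle_trans; [apply lipschitz_layer|]. rewrite Rmult_1_l, <- RIneq.Rdiv_minus_distr.
rewrite Rabs_div, (Rabs_pos_eq V) by lra. apply Rle_div_l; [lra|].
pose proof (Hf (INR (S x) / INR Q) (INR x / INR Q)) as Hstep.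
replace (INR (S x) / INR Q - INR x / INR Q) with (/ INR Q) in Hstep
  by (rewrite S_INR; field; lra).
rewrite (Rabs_pos_eq (/ INR Q)) in Hstep by (left; now apply Rinv_0_lt_compat).
pose proof (Rabs_pos (f (INR (S x) / INR Q) - f (INR x / INR Q))).
unfold Rdiv in *. nra.
Qed.

Theorem few_points_with_small_dilates f L V r (Q H : nat) :
  lipschitz L f -> (forall x, f (x + 1) = f x) -> (forall x, f x <= INR H) ->
  1 <= L -> 1 <= V -> (0 < H)%nat -> 16 * INR H ^ 4 * L ^ 2 <= INR Q ->
  divisor_count_le Q r -> 4 * V <= RInt f 0 1 ->
  exists l : list nat, INR (length l) <= 12 * r * V * INR Q / RInt f 0 1 /\
    forall x, (x < Q)%nat ->
      (forall h, (1 <= h <= H)%nat -> f (INR (h * x) / INR Q) <= INR h * V) -> In x l.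
Proof.
intros Hf Hper HfH HL HV HH HQbig Hdiv HU. set (U := RInt f 0 1 : R) in *.
assert (HH1 : 1 <= INR H) by (apply (le_INR 1); lia).
assert (HH4 : INR H <= INR H ^ 4) by (rewrite <- (pow_1 (INR H)) at 1; apply Rle_pow; [lra|lia]).
assert (HL2 : L <= L ^ 2) by nra.
assert (HHLQ : 16 * (INR H * L) <= INR Q).
{ eapply Rle_trans; [|exact HQbig]. rewrite Rmult_assoc.
  apply Rmult_le_compat_l; [lra|]. apply Rmult_le_compat; lra. }
assert (HHL : INR H <= INR H * L) by nra.
assert (HQ4 : (4 * H <= Q)%nat) by (apply INR_le; rewrite mult_INR; simpl; lra).
assert (HQ : (0 < Q)%nat) by lia.
assert (Hq : 0 < INR Q) by (apply lt_0_INR; lia).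
destruct (exists_frequency_cutoff Q H HH HQ4) as [K [HK0 [HKQ HQK]]].
assert (Hr : 1 <= r) by (eapply Rle_trans; [|apply (Hdiv 1%nat); lia]; simpl; lra).
set (G := fun h x => layer h (f (INR x / INR Q) / V)).
set (mu := ssum (fun h => grid_average Q (G h)) H).
assert (Hmu : U / (2 * V) <= mu).
{ eapply Rle_trans; [|apply (grid_average_layers_ge f L V Q H); try assumption; nra].
  fold U. assert (4 <= U / V) by (apply -> Rle_div_r; lra).
  replace (U / (2 * V)) with (U / V / 2) by (field; lra). lra. }
assert (HUV : 2 <= U / (2 * V)) by (apply Rle_div_r; lra).
destruct (@GridDilation.few_annihilated_points Q K H G (L / INR Q) mu r)
  as [l [Hl Hlen]]; [exact HK0 | nia | nia | | | | lra | | reflexivity |].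
- intros h y. unfold G. now rewrite plus_INR, Rdiv_plus_distr, Rdiv_diag, Hper by lra.
- intros h x. apply layer_bounds.
- intros h x. now apply grid_layer_step_le.
- intros n Hn. apply Hdiv. nia.
- exists l. split.
  + apply Rle_trans with (6 * r * INR Q / mu).
    * apply (count_le_of_variance _ _ _ _ (INR H) (INR K) L); try lra.
      -- apply lt_0_INR; lia.
      -- apply le_INR in HQK. rewrite !mult_INR in HQK. simpl in HQK. lra.
    * replace (12 * r * V * INR Q / U) with (6 * r * INR Q * / (U / (2 * V))) by (field; lra).
      apply Rmult_le_compat_l; [nra|]. apply Rinv_le_contravar; lra.
  + intros x Hx Hsmall. apply Hl; [exact Hx|]. intros h Hh1 HhH.
    apply layer_eq0, Rle_div_l; [lra|]. now apply Hsmall.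
Qed.

Definition in_grid_cells (Q : nat) (l : list nat) (y : R) : Prop :=
  exists x, In x l /\ INR x / INR Q <= y < (INR x + 1) / INR Q.

Lemma exists_grid_cell q alpha : (0 < q)%nat -> 0 <= alpha < 1 ->
  exists x, (x < q)%nat /\ INR x / INR q <= alpha < (INR x + 1) / INR q.
Proof.
intros Hq Ha. apply lt_0_INR in Hq.
destruct (nfloor_ex (alpha * INR q)) as [x Hx]; [nra|].
exists x. split; [apply INR_lt; nra|].
split; [apply Rle_div_l | apply Rlt_div_r]; lra.
Qed.

Lemma lipschitz_dilate_grid_cell f L Q h x alpha : (0 < Q)%nat -> lipschitz L f ->
  0 <= L <= INR Q -> INR x / INR Q <= alpha < (INR x + 1) / INR Q ->
  f (INR (h * x) / INR Q) <= f (INR h * alpha) + INR h.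
Proof.
intros HQ Hf HL Hx. apply lt_0_INR in HQ. pose proof (pos_INR h).
assert (Hclose : Rabs (INR (h * x) / INR Q - INR h * alpha) <= INR h / INR Q).
{ rewrite mult_INR.
  replace (INR h * INR x / INR Q - INR h * alpha)
    with (- (INR h * (alpha - INR x / INR Q))) by (field; lra).
  rewrite Rabs_Ropp, Rabs_pos_eq by (apply Rmult_le_pos; lra).
  apply Rmult_le_compat_l; [lra|].
  replace ((INR x + 1) / INR Q) with (INR x / INR Q + / INR Q) in Hx by (field; lra). lra. }
assert (L * Rabs (INR (h * x) / INR Q - INR h * alpha) <= INR h).
{ apply Rle_trans with (L * (INR h / INR Q)); [apply Rmult_le_compat_l; lra|].
  replace (L * (INR h / INR Q)) with (L * INR h / INR Q) by (field; lra).
  apply Rle_div_l; nra. }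
pose proof (Hf (INR (h * x) / INR Q) (INR h * alpha)).
pose proof (Rle_abs (f (INR (h * x) / INR Q) - f (INR h * alpha))). lra.
Qed.

Theorem small_scaled_discrepancy_cells (a : nat -> Z) (N Q : nat) (A W r : R) :
  (0 < N)%nat -> (forall n, (1 <= n <= N)%nat -> Rabs (IZR (a n)) <= A) -> 1 <= A ->
  16 * INR N ^ 4 * (2 * PI * INR N * A) ^ 2 <= INR Q ->
  divisor_count_le Q r ->
  0 <= W -> 4 * (2 * PI * W + 1) <= RInt (exp_sum_abs a N) 0 1 ->
  exists l : list nat,
    INR (length l) <=
      12 * r * (2 * PI * W + 1) * INR Q / RInt (exp_sum_abs a N) 0 1 /\
    forall alpha, 0 <= alpha < 1 -> scaled_discrepancy a N alpha <= W ->
      in_grid_cells Q l alpha.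
Proof.
intros HN HA HA1 HQbig Hdiv HW HU. pose proof PI2_1. pose proof PI2_3_2.
set (L := 2 * PI * INR N * A) in *.
assert (HN1 : 1 <= INR N) by (apply (le_INR 1); lia).
assert (HL : 1 <= L) by (unfold L; assert (1 <= PI * INR N) by nra; nra).
assert (HLQ : L <= INR Q).
{ eapply Rle_trans; [|exact HQbig].
  assert (1 <= INR N ^ 4) by (now apply pow_R1_Rle). nra. }
assert (HQ : (0 < Q)%nat) by (apply INR_lt; simpl; lra).
assert (Hq : 0 < INR Q) by lra.
pose proof (exp_sum_abs_lipschitz a N A HA) as Hlip. fold L in Hlip.
destruct (few_points_with_small_dilates (exp_sum_abs a N) L (2 * PI * W + 1) r Q N)
  as [l [Hlen Hl]]; try assumption.
- apply exp_sum_abs_periodic.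
- apply exp_sum_abs_le.
- nra.
- exists l. split; [exact Hlen|]. intros alpha Ha Hsmall.
  destruct (exists_grid_cell Q alpha HQ Ha) as [x [HxQ Hx]].
  exists x. split; [|exact Hx]. apply Hl; [exact HxQ|]. intros h Hh.
  pose proof (exp_sum_abs_le_scaled_discrepancy a N h alpha HN ltac:(lia)) as Hkoksma.
  pose proof (lipschitz_dilate_grid_cell _ L Q h x alpha HQ Hlip ltac:(lra) Hx).
  assert (HhR : 0 < INR h) by (apply lt_0_INR; lia).
  assert (2 * PI * INR h * scaled_discrepancy a N alpha <= 2 * PI * INR h * W)
    by (apply Rmult_le_compat_l; nra).
  lra.
Qed.

Lemma interval_total_cells q l : 0 < q ->
  interval_total (map (fun x => ((INR x - 1) / q, (INR x + 1) / q)) l) =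
  INR (length l) * (2 / q).
Proof.
intros Hq. induction l as [|x l IH]; [simpl; ring|].
cbn [map interval_total fold_right length fst snd]. rewrite S_INR.
unfold interval_total in IH. rewrite IH. field. lra.
Qed.

(* The cells are half-open, so each is enlarged to an open interval of twice its length. *)
Lemma content_zero_of_cells (E : R -> Prop) :
  (forall eta, 0 < eta -> exists (Q : nat) (l : list nat), (0 < Q)%nat /\
     2 * INR (length l) <= eta * INR Q /\ forall y, E y -> in_grid_cells Q l y) ->
  content_zero E.
Proof.
intros Hcells eta Heta. destruct (Hcells eta Heta) as [Q [l [HQ [Hlen Hl]]]].
apply lt_0_INR in HQ. pose proof (Rinv_0_lt_compat _ HQ).
exists (map (fun x => ((INR x - 1) / INR Q, (INR x + 1) / INR Q)) l). repeat split.
- apply Forall_map, Forall_forall. intros x _. simpl. unfold Rdiv. nra.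
- rewrite interval_total_cells by exact HQ.
  replace (INR (length l) * (2 / INR Q)) with (2 * INR (length l) / INR Q) by (field; lra).
  now apply Rle_div_l.
- intros y Hy. destruct (Hl y Hy) as [x [Hx Hxy]].
  exists ((INR x - 1) / INR Q, (INR x + 1) / INR Q). split.
  + apply in_map_iff. now exists x.
  + simpl. unfold Rdiv in *. nra.
Qed.

Lemma Rpower_eventually_ge c e : 0 < e ->
  exists M : nat, forall n, (M <= n)%nat -> c <= Rpower (INR n) e.
Proof.
intros He. destruct (Rle_lt_dec c 0) as [Hc|Hc].
{ exists 0%nat. intros n _. left. apply Rle_lt_trans with (1 := Hc), exp_pos. }
assert (Hroot : 0 < Rpower c (/ e)) by apply exp_pos.
destruct (INR_unbounded (Rpower c (/ e))) as [M HM].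
exists M. intros n Hn. apply le_INR in Hn.
replace c with (Rpower (Rpower c (/ e)) e).
- apply Rle_Rpower_l; lra.
- rewrite Rpower_mult, Rinv_l, Rpower_1; lra.
Qed.

Lemma divisor_count_eventually_le w e : 0 < e ->
  exists M : nat, forall N, (M <= N)%nat -> divisor_count_le (N ^ w) (Rpower (INR N) e).
Proof.
intros He. set (d := e / 2 / (INR w + 1)). pose proof (pos_INR w).
assert (Hd : 0 < d) by (apply Rdiv_lt_0_compat; lra).
destruct (DivisorBound.divisor_bound_Rpower Hd) as [C HC].
destruct (Rpower_eventually_ge C (e / 2)) as [M HM]; [lra|].
exists (S M). intros N HN n Hn.
assert (HN1 : 1 <= INR N) by (apply (le_INR 1); lia).
assert (HnN : Rpower (INR n) d <= Rpower (INR N) (e / 2)).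
{ apply Rle_trans with (Rpower (INR N ^ w) d).
  - apply Rle_Rpower_l; [lra|]. split; [apply lt_0_INR; lia|].
    rewrite <- pow_INR. apply le_INR. lia.
  - rewrite <- Rpower_pow, Rpower_mult by lra. apply Rle_Rpower; [exact HN1|].
    unfold d. apply Rmult_le_reg_r with (INR w + 1); [lra|].
    field_simplify; nra. }
eapply Rle_trans; [apply HC; lia|].
replace e with (e / 2 + e / 2) by field. rewrite Rpower_plus.
assert (0 < Rpower (INR n) d) by apply exp_pos.
assert (0 < Rpower (INR N) (e / 2)) by apply exp_pos.
specialize (HM N ltac:(lia)). nra.
Qed.

Lemma polynomial_growth_uniform (a : nat -> Z) t n0 :
  (forall n, (n0 <= n)%nat -> Rabs (IZR (a n)) <= INR n ^ t) ->
  exists M : nat, forall N, (M <= N)%nat -> forall n, (1 <= n <= N)%nat ->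
    Rabs (IZR (a n)) <= INR N ^ S t.
Proof.
intros Hgrowth.
assert (Hprefix : forall k, exists c, forall n, (n < k)%nat -> Rabs (IZR (a n)) <= c).
{ induction k as [|k [c Hc]]; [exists 0; lia|].
  exists (Rmax c (Rabs (IZR (a k)))). intros n Hn.
  destruct (Nat.eq_dec n k) as [->|Hnk]; [apply Rmax_r|].
  eapply Rle_trans; [apply Hc; lia | apply Rmax_l]. }
destruct (Hprefix n0) as [c Hc]. destruct (INR_unbounded c) as [M HM].
exists M. intros N HN n Hn.
assert (HN1 : 1 <= INR N) by (apply (le_INR 1); lia).
assert (HNt : 1 <= INR N ^ t) by (now apply pow_R1_Rle).
apply le_INR in HN. simpl pow.
destruct (Nat.le_gt_cases n0 n) as [Hn0|Hn0].
- eapply Rle_trans; [apply Hgrowth, Hn0|].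
  assert (INR n ^ t <= INR N ^ t); [|nra].
  apply pow_incr. split; [apply pos_INR|apply le_INR; lia].
- specialize (Hc n Hn0). nra.
Qed.

Lemma grid_fineness_le_pow n t : 1024 <= n ->
  16 * n ^ 4 * (2 * PI * n * n ^ S t) ^ 2 <= n ^ (2 * t + 9).
Proof.
intros Hn. pose proof PI_4. pose proof PI_RGT_0.
replace (16 * n ^ 4 * (2 * PI * n * n ^ S t) ^ 2) with (64 * PI ^ 2 * n ^ (2 * t + 8)).
2:{ replace (2 * t + 8)%nat with (S t + S t + 6)%nat by lia. rewrite !pow_add. ring. }
replace (2 * t + 9)%nat with (S (2 * t + 8)) by lia.
apply Rmult_le_compat_r; [apply pow_le; lra | nra].
Qed.

Lemma threshold_le_mean_bounds y W U eta : 0 < eta -> 36 + 216 / eta <= y -> 1 <= W ->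
  W * y ^ 3 < U ->
  4 * (2 * PI * W + 1) <= U /\ 24 * y * (2 * PI * W + 1) <= eta * U.
Proof.
intros Heta Hy HW HU. pose proof PI_4. pose proof PI_RGT_0.
assert (0 < 216 / eta) by (apply Rdiv_lt_0_compat; lra).
assert (HV : 2 * PI * W + 1 <= 9 * W) by nra.
split.
- assert (36 <= y ^ 3) by nra. nra.
- apply Rle_trans with (24 * y * (9 * W)); [apply Rmult_le_compat_l; lra|].
  apply Rle_trans with (eta * (W * y ^ 3)); [|apply Rmult_le_compat_l; lra].
  replace (eta * (W * y ^ 3)) with (eta * y * y * (W * y)) by ring.
  replace (24 * y * (9 * W)) with (216 * (W * y)) by ring.
  assert (216 <= eta * y) by (rewrite Rmult_comm; apply Rle_div_l; lra).
  apply Rmult_le_compat_r; nra.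
Qed.

Theorem content_zero_eventually_small_discrepancy (a : nat -> Z) (t n0 M : nat) (tau eps : R) :
  (forall n, (n0 <= n)%nat -> Rabs (IZR (a n)) <= INR n ^ t) ->
  (forall e (M : nat), 0 < e -> exists N, (M <= N)%nat /\
     Rpower (INR N) (tau - e) < RInt (exp_sum_abs a N) 0 1) ->
  0 < eps <= tau ->
  content_zero (fun alpha => 0 <= alpha < 1 /\ forall N, (M < N)%nat ->
    scaled_discrepancy a N alpha <= Rpower (INR N) (tau - eps)).
Proof.
intros Hgrowth Hmean Heps. apply content_zero_of_cells. intros eta Heta.
set (e := eps / 4). assert (He : 0 < e) by (unfold e; lra).
destruct (polynomial_growth_uniform a t n0 Hgrowth) as [M1 HM1].
destruct (Rpower_eventually_ge (36 + 216 / eta) e He) as [M2 HM2].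
set (w := (2 * t + 9)%nat).
destruct (divisor_count_eventually_le w e He) as [M3 HM3].
destruct (Hmean e (M + M1 + M2 + M3 + 1024)%nat He) as [N [HN HU]].
set (n := INR N) in *. set (U := RInt (exp_sum_abs a N) 0 1 : R) in *.
assert (Hn : 1024 <= n).
{ replace 1024 with (INR 1024) by (rewrite INR_IZR_INZ; reflexivity). apply le_INR; lia. }
set (y := Rpower n e). set (W := Rpower n (tau - eps)).
assert (Hy : 36 + 216 / eta <= y) by (apply HM2; lia).
assert (HW : 1 <= W).
{ unfold W. rewrite <- (Rpower_O n) by lra. apply Rle_Rpower; lra. }
assert (HWU : W * y ^ 3 < U).
{ eapply Rle_lt_trans; [right|exact HU]. unfold W, y.
  rewrite <- Rpower_pow, Rpower_mult, <- Rpower_plus by apply exp_pos.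
  f_equal. unfold e. simpl. field. }
destruct (threshold_le_mean_bounds y W U eta Heta Hy HW HWU) as [HVU HyVU].
assert (HU0 : 0 < U).
{ assert (0 < y ^ 3) by (apply pow_lt, exp_pos). nra. }
exists (N ^ w)%nat.
destruct (small_scaled_discrepancy_cells a N (N ^ w) (n ^ S t) W y) as [l [Hlen Hl]].
- lia.
- apply HM1. lia.
- apply pow_R1_Rle. lra.
- rewrite pow_INR. now apply grid_fineness_le_pow.
- apply HM3. lia.
- lra.
- exact HVU.
- exists l. repeat split.
  + apply Nat.neq_0_lt_0, Nat.pow_nonzero. lia.
  + fold U in Hlen. apply Rle_div_r in Hlen; [|exact HU0].
    apply Rmult_le_compat_r with (r := INR (N ^ w)) in HyVU; [|apply pos_INR].
    apply Rmult_le_reg_r with U; [exact HU0 | lra].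
  + intros alpha [Ha Hsmall]. apply Hl; [exact Ha|]. apply Hsmall. lia.
Qed.

Lemma le_of_strictly_increasing (u : nat -> nat) :
  (forall L, (1 <= L)%nat -> (0 < u L)%nat) ->
  (forall L, (1 <= L)%nat -> (u L < u (S L))%nat) ->
  forall L, (1 <= L)%nat -> (L <= u L)%nat.
Proof.
intros Hpos Hincr L HL. induction HL as [|L HL IH]; [apply (Hpos 1%nat); lia|].
pose proof (Hincr L HL). lia.
Qed.

Lemma frequently_large_mean (a : nat -> Z) (tau : R) (BL : nat -> nat) :
  (forall L, (1 <= L)%nat -> (L <= BL L)%nat) ->
  (forall eps, 0 < eps -> exists L0 : nat, forall L, (L0 < L)%nat ->
     exists pr : Riemann_integrable (exp_sum_abs a (BL L)) 0 1,
       RiemannInt pr > Rpower (INR (BL L)) (tau - eps)) ->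
  forall e (M : nat), 0 < e -> exists N, (M <= N)%nat /\
    Rpower (INR N) (tau - e) < RInt (exp_sum_abs a N) 0 1.
Proof.
intros HBL Hint e M He. destruct (Hint e He) as [L0 HL0].
destruct (HL0 (S (L0 + M)) ltac:(lia)) as [pr Hpr]. exists (BL (S (L0 + M))). split.
- specialize (HBL (S (L0 + M)) ltac:(lia)). lia.
- now rewrite (RInt_Reals _ _ _ pr).
Qed.

Lemma eventually_small_of_not_frequently_large (D : nat -> R) tau : 0 < tau ->
  ~ (forall eps, 0 < eps -> forall M : nat, exists N : nat, (M < N)%nat /\
       D N > Rpower (INR N) (tau - eps)) ->
  exists p : nat, forall N, (p < N)%nat -> D N <= Rpower (INR N) (tau - tau / (INR p + 1)).
Proof.
intros Htau Hfail.
apply not_all_ex_not in Hfail as [eps Hfail]. apply imply_to_and in Hfail as [Heps Hfail].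
apply not_all_ex_not in Hfail as [M HM].
destruct (INR_unbounded (tau / eps)) as [P HP].
exists (P + M)%nat. intros N HN. apply Rle_trans with (Rpower (INR N) (tau - eps)).
- apply Rnot_lt_le. intros Hgt. apply HM. exists N. split; [lia|exact Hgt].
- apply Rle_Rpower; [apply (le_INR 1); lia|].
  apply Rlt_div_l in HP; [|lra]. rewrite plus_INR. pose proof (pos_INR P). pose proof (pos_INR M).
  assert (tau / (INR P + INR M + 1) <= eps) by (apply Rle_div_l; nra). lra.
Qed.

Theorem theorem3 (a : nat -> Z) (tau B' B : R) (BL : nat -> nat) :
  (exists (t n0 : nat), forall n, (n0 <= n)%nat -> Rabs (IZR (a n)) <= INR n ^ t) ->
  0 < tau < 1 ->
  1 < B' -> B' < B ->
  (forall L, (1 <= L)%nat -> (0 < BL L)%nat) ->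
  (forall L, (1 <= L)%nat -> (BL L < BL (S L))%nat) ->
  (forall L, (1 <= L)%nat -> B' ^ L <= INR (BL L) <= B ^ L) ->
  (forall eps, 0 < eps -> exists L0 : nat, forall L, (L0 < L)%nat ->
     exists pr : Riemann_integrable (exp_sum_abs a (BL L)) 0 1,
       RiemannInt pr > Rpower (INR (BL L)) (tau - eps)) ->
  null_set (fun alpha => 0 <= alpha < 1 /\
    ~ (forall eps, 0 < eps -> forall M : nat, exists N : nat, (M < N)%nat /\
         INR N * discrepancy (fun n => frac_part (IZR (a n) * alpha)) N
           > Rpower (INR N) (tau - eps))).
Proof.
intros [t [n0 Hgrowth]] Htau _ _ Hpos Hincr _ Hint.
pose proof (le_of_strictly_increasing BL Hpos Hincr) as HBL.
apply (null_set_of_content_zero_cover _ (fun p alpha => 0 <= alpha < 1 /\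
  forall N, (p < N)%nat -> scaled_discrepancy a N alpha
    <= Rpower (INR N) (tau - tau / (INR p + 1)))).
- intros alpha [Ha Hfail].
  destruct (eventually_small_of_not_frequently_large
    (fun N => scaled_discrepancy a N alpha) tau (proj1 Htau) Hfail) as [p Hp].
  now exists p.
- intros p. pose proof (pos_INR p).
  apply (content_zero_eventually_small_discrepancy a t n0 p tau); [exact Hgrowth | |].
  + exact (frequently_large_mean a tau BL HBL Hint).
  + split; [apply Rdiv_lt_0_compat; lra | apply Rle_div_l; nra].
Qed.
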